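(* For square-free integers $1<m<s<t$ such that $\mathbb{Q}(\sqrt{m},\sqrt{s})$ is a biquadratic field containing $\sqrt{t}$, define for each $u\in\{m,s,t\}$ the element \[ \mathcal{U}=\begin{cases}\lceil\sqrt{u}\,\rceil+\sqrt{u} & \text{if } u\equiv 2,3\pmod 4,\\[2pt] \dfrac{\lceil\sqrt{u}\,\rceil^{\mathrm{odd}}+\sqrt{u}}{2} & \text{if } u\equiv 1\pmod 4,\end{cases} \] where $\lceil\sqrt{u}\,\rceil$ is the smallest integer greater than $\sqrt{u}$ and $\lceil\sqrt{u}\,\rceil^{\mathrm{odd}}$ is the smallest odd integer greater than $\sqrt{u}$; denote this element by $\mathcal{M}$, $\mathcal{S}$, $\mathcal{T}$ for $u=m,s,t$ respectively. Then: (1) for all such $m,s,t$, both $\mathcal{M}$ and $\mathcal{S}$ are indecomposable in $\mathbb{Q}(\sqrt{m},\sqrt{s})$; (2) for all such $m,s,t$, if $2\mathcal{M}-1$ is totally positive, then it is indecomposable in $\mathbb{Q}(\sqrt{m},\sqrt{s})$; (3) $\mathcal{T}$ can decompose in $\mathbb{Q}(\sqrt{m},\sqrt{s})$, i.e., there exist such $m,s,t$ for which $\mathcal{T}$ is not indecomposable in $\mathbb{Q}(\sqrt{m},\sqrt{s})$.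
   Context: For a totally real number field $K$ with ring of integers $\mathcal{O}_K$, an element $\alpha\in K$ is totally positive if $\sigma(\alpha)>0$ for every embedding $\sigma$ of $K$ into $\mathbb{R}$; $\mathcal{O}_K^+$ denotes the set of totally positive elements of $\mathcal{O}_K$. An element $\alpha\in\mathcal{O}_K^+$ is indecomposable in $K$ if there are no $\beta,\gamma\in\mathcal{O}_K^+$ with $\alpha=\beta+\gamma$. A (totally real) biquadratic field is one of the form $\mathbb{Q}(\sqrt{p},\sqrt{q})$ with $p,q>1$ distinct square-free integers. *)

(* Defs.v *)
From HB Require Import structures.
From mathcomp Require Import all_boot all_order all_algebra.
From mathcomp Require Import boolp reals.

Set Implicit Arguments.
Unset Strict Implicit.
Unset Printing Implicit Defensive.

Import Order.TTheory GRing.Theory Num.Theory.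

Local Open Scope ring_scope.

Definition square_free (n : nat) : Prop :=
  forall d : nat, (d ^ 2 %| n)%N -> d = 1%N.

Section Indecomposables.
Variables (R : realType) (K : fieldType).

Definition totally_positive (a : K) : Prop :=
  forall sigma : {rmorphism K -> R}, 0 < sigma a.

Definition integer_of (a : K) : Prop := integralOver (intr : int -> K) a.

Definition OKplus (a : K) : Prop := integer_of a /\ totally_positive a.

Definition indecomposable (a : K) : Prop :=
  OKplus a /\ ~ exists b c : K, [/\ OKplus b, OKplus c & a = b + c].

End Indecomposables.
Arguments totally_positive R {K} a.
Arguments OKplus R {K} a.
Arguments indecomposable R {K} a.

Section GeneratedSubfield.
Variables (R : realType) (A : seq R).

(* Intersection of all subfields of R containing A.  Since 0^-1 = 0, a
   subset of R is a subfield exactly when it is divring_closed. *)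
Definition subfield_gen : {pred R} := fun x =>
  `[< forall F : {pred R}, divring_closed F -> {subset A <= F} -> x \in F >].

Lemma subfield_genP x :
  reflect (forall F : {pred R},
             divring_closed F -> {subset A <= F} -> x \in F)
          (x \in subfield_gen).
Proof. exact: asboolP. Qed.

Lemma mem_subfield_gen : {subset A <= subfield_gen}.
Proof. by move=> x Ax; apply/subfield_genP => F _; apply. Qed.

Lemma subfield_gen_closed : divring_closed subfield_gen.
Proof.
split.
- by apply/subfield_genP => F [].
- move=> x y /subfield_genP xP /subfield_genP yP; apply/subfield_genP => F cF AF.
  by have [_ sF _] := cF; apply: sF; [exact: xP | exact: yP].
- move=> x y /subfield_genP xP /subfield_genP yP; apply/subfield_genP => F cF AF.
  by have [_ _ dF] := cF; apply: dF; [exact: xP | exact: yP].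
Qed.

HB.instance Definition _ :=
  GRing.isDivringClosed.Build R subfield_gen subfield_gen_closed.

(* The same subfield, as a field in its own right. *)
Record Qadj := InQadj { Qadj_val : R; Qadj_mem : Qadj_val \in subfield_gen }.

HB.instance Definition _ := [isSub for Qadj_val].
HB.instance Definition _ := [Choice of Qadj by <:].
HB.instance Definition _ := [SubChoice_isSubIntegralDomain of Qadj by <:].
HB.instance Definition _ := [SubIntegralDomain_isSubField of Qadj by <:].

End GeneratedSubfield.

Section Quadratic.
Variable R : realType.

Definition rsqrt (u : nat) : R := Num.sqrt u%:R.

Lemma ex_gt_rsqrt u : exists n : nat, rsqrt u < n%:R.
Proof. by exists (Num.bound (rsqrt u)); rewrite archi_boundP// sqrtr_ge0. Qed.

Lemma ex_odd_gt_rsqrt u : exists n : nat, odd n && (rsqrt u < n%:R).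
Proof.
have [n un] := ex_gt_rsqrt u; exists n.*2.+1; rewrite /= odd_double /=.
by rewrite (lt_le_trans un)// ler_nat -addnn -addnS leq_addr.
Qed.

(* Least (odd) integer strictly above the square root of u; as the root is
   nonnegative, it suffices to search among the natural numbers. *)
Definition ceil_sqrt (u : nat) : nat := ex_minn (ex_gt_rsqrt u).
Definition odd_ceil_sqrt (u : nat) : nat := ex_minn (ex_odd_gt_rsqrt u).

(* The element attached to u in the field generated by A, given that this
   field contains the square root of u.  For square-free u, the second branch
   is the case u = 2, 3 mod 4. *)
Definition calU (A : seq R) (u : nat) (hu : rsqrt u \in subfield_gen A) :
    Qadj A :=
  let r : Qadj A := InQadj hu in
  if (u %% 4 == 1)%N then ((odd_ceil_sqrt u)%:R + r) / 2%:R
  else (ceil_sqrt u)%:R + r.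

Definition sqrts (p q : nat) : seq R := [:: rsqrt p; rsqrt q].

Definition biquadratic (F : {pred R}) : Prop :=
  exists p q : nat,
    [/\ (1 < p)%N /\ (1 < q)%N, p <> q, square_free p, square_free q
      & F =i subfield_gen (sqrts p q)].

Lemma rsqrt_meml p q : rsqrt p \in subfield_gen (sqrts p q).
Proof. by apply: mem_subfield_gen; rewrite inE eqxx. Qed.

Lemma rsqrt_memr p q : rsqrt q \in subfield_gen (sqrts p q).
Proof. by apply: mem_subfield_gen; rewrite !inE eqxx orbT. Qed.

Definition admissible (m s t : nat) : Prop :=
  [/\ [/\ (1 < m)%N, (m < s)%N & (s < t)%N],
      [/\ square_free m, square_free s & square_free t],
      biquadratic (subfield_gen (sqrts m s))
    & rsqrt t \in subfield_gen (sqrts m s)].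

End Quadratic.
Arguments rsqrt R u : clear implicits.
Arguments sqrts R p q : clear implicits.
Arguments admissible R m s t : clear implicits.
Arguments rsqrt_meml R p q : clear implicits.
Arguments rsqrt_memr R p q : clear implicits.

(* Main.v *)
From HB Require Import structures.
Require Import Defs.
From mathcomp Require Import all_boot all_order all_algebra.
From mathcomp Require Import boolp reals.
From mathcomp Require Import algC algnum.
From mathcomp Require Import zify ring lra.

Set Implicit Arguments.
Unset Strict Implicit.
Unset Printing Implicit Defensive.

Import Order.TTheory GRing.Theory Num.Theory.

Local Open Scope ring_scope.

(** Let K = Q(sqrt m, sqrt s).  Write m = g a, s = g b with a, b coprime; then
    t = a b and g < a < b, and K has the three quadratic subfields generated
    by the roots of g a, g b and a b.  To treat M and S at once, call u = g a
    the radicand under study, v = g b and w = a b the other two; exchanging a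
    and b exchanges the roles of m and s.  In both cases w is larger than u.

    Suppose that a totally positive integer of Q(sqrt u) is a sum beta + gamma
    of totally positive integers of K.  Its double is then the sum of the
    traces of beta and gamma to Q(sqrt u), which are totally positive integers
    of that field.  Write U for the element attached to u.  An elementary
    estimate in Q(sqrt u) shows that 2 U splits only as U + U or as
    1 + (2 U - 1), and that 4 U - 2 splits only as (2 U - 1) + (2 U - 1), as
    U + (3 U - 2) or as 1 + (4 U - 3) (trace_split_two, trace_split_four).  So
    it is enough to prove that no totally positive integer of K has trace 1 or
    U, nor 2 U - 1 when u is the smallest radicand: this is no_trace_one,
    no_trace_calU_mod1, no_trace_calU_mod23, no_trace_twice_mod1 and
    no_trace_twice_mod23.

    For these, write beta = (X + Y sqrt u + Z sqrt v + W sqrt w) / 4.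
    Integrality of beta makes the coordinates integers and gives congruences:
    the relative traces to the three quadratic subfields and the relative norm
    to Q(sqrt u) are integers of quadratic fields.  Positivity of the four
    conjugates gives the size conditions u Y^2, v Z^2, w W^2 < X^2, and bounds
    the difference of Z sqrt v and W sqrt w by X - Y sqrt u, which is small
    because the smaller conjugate of U or 2 U - 1 lies between 0 and 1
    (positive_gap).  With the trace prescribed, W must have its least nonzero
    size, which confines w.  In most cases w then lies in the same short
    interval between two squares as u.  But w - u = a (b - g) is a multiple of
    a, and a is larger than sqrt u because a > g: this is too much for the
    interval, unless b = g + 1.  That exception occurs only for S; there the
    congruences modulo 4 force Z / 2 to be odd and a >= b + 4, against the bound
    on the difference.  For 2 U - 1 with u = 2, 3 mod 4, the size of Z has to be
    discussed as well.

    To use total positivity, the four embeddings of K into the reals have to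
    be constructed (exists_conjugation); they are read off coordinates in the
    basis 1, sqrt m, sqrt s, sqrt m sqrt s, whose independence over Q comes
    from unique factorisation.

    For T, take (m, s, t) = (3, 10, 30), where T = 6 + sqrt 30 is the sum of
    3 + sqrt 3 + (sqrt 30 + sqrt 10) / 2 and its conjugate
    3 - sqrt 3 + (sqrt 30 - sqrt 10) / 2. *)

(** * Square-free integers *)

Lemma square_free_gt0 u : square_free u -> (0 < u)%N.
Proof. by case: u => // /(_ 2) /= /(_ isT). Qed.

Lemma logn_square_free p u : square_free u -> (logn p u <= 1)%N.
Proof.
move=> su; have u0 := square_free_gt0 su.
have [pp|/negbTE np] := boolP (prime p); last by rewrite lognE np.
rewrite leqNgt -pfactor_dvdn//; apply/negP => /su p1.
by rewrite p1 in pp.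
Qed.

Lemma square_free_square_ratio_nat (u v X Y : nat) :
  square_free u -> square_free v -> (0 < X)%N -> (0 < Y)%N ->
  (X ^ 2 * u = Y ^ 2 * v)%N -> u = v.
Proof.
move=> su sv X0 Y0 eXY.
have u0 := square_free_gt0 su; have v0 := square_free_gt0 sv.
apply: eqn_from_log => // p.
have := congr1 (logn p) eXY; rewrite !lognM ?muln_gt0 ?expn_gt0 ?X0 ?Y0 ?u0 ?v0 //.
have := logn_square_free p su; have := logn_square_free p sv; lia.
Qed.

(** A square-free integer is determined by its class modulo nonzero rational
    squares. *)
Lemma square_free_square_ratio (u v : nat) (x y : rat) :
  square_free u -> square_free v -> x ^+ 2 * u%:R = y ^+ 2 * v%:R ->
  u = v \/ x = 0 /\ y = 0.
Proof.
move=> su sv e.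
have u0 := square_free_gt0 su; have v0 := square_free_gt0 sv.
have unz : u%:R != 0 :> rat by rewrite pnatr_eq0 -lt0n.
have vnz : v%:R != 0 :> rat by rewrite pnatr_eq0 -lt0n.
have [x0|xnz] := eqVneq x 0.
  right; split => //; move/eqP: e; rewrite x0 expr0n mul0r eq_sym mulf_eq0.
  by rewrite (negbTE vnz) orbF expf_eq0 => /eqP.
have [y0|ynz] := eqVneq y 0.
  move/eqP: e; rewrite y0 expr0n mul0r mulf_eq0.
  by rewrite (negbTE unz) orbF expf_eq0 /= (negbTE xnz).
left; apply: (@square_free_square_ratio_nat _ _ `|(numq x * denq y)%R|%N
                 `|(numq y * denq x)%R|%N su sv).
- by rewrite absz_gt0 mulf_neq0 ?numq_eq0 ?denq_neq0.
- by rewrite absz_gt0 mulf_neq0 ?numq_eq0 ?denq_neq0.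
suff: (numq x * denq y) ^+ 2 * u%:Z = (numq y * denq x) ^+ 2 * v%:Z.
  by rewrite !expr2 => /(congr1 absz); rewrite !abszM -!mulnn.
apply/eqP; rewrite -(eqr_int rat) !expr2 !rmorphM /=; apply/eqP.
move: e; rewrite -[in x ^+ 2](divq_num_den x) -[in y ^+ 2](divq_num_den y).
have dx : (denq x)%:Q != 0 by rewrite intr_eq0 denq_neq0.
have dy : (denq y)%:Q != 0 by rewrite intr_eq0 denq_neq0.
rewrite !expr_div_n => e.
move: e; rewrite -!expr2 => e.
transitivity ((numq x)%:Q ^+ 2 / (denq x)%:Q ^+ 2 * u%:R
   * (denq x)%:Q ^+ 2 * (denq y)%:Q ^+ 2); first by field.
by rewrite e; field; exact: dy.
Qed.

(** The square of the denominator of r divides u. *)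
Lemma square_free_mul_square_int (u : nat) (r : rat) (N : int) :
  square_free u -> u%:R * r ^+ 2 = N%:~R -> exists n : int, r = n%:~R.
Proof.
move=> su e; exists (numq r); rewrite -[LHS]divq_num_den.
have dn0 : (denq r)%:Q != 0 by rewrite intr_eq0 denq_neq0.
suff -> : denq r = 1 by rewrite divr1.
have {e} : u%:Z * numq r ^+ 2 = N * denq r ^+ 2.
  apply/eqP; rewrite -(eqr_int rat) !expr2 !rmorphM /=; apply/eqP.
  rewrite -e -[in r ^+ 2](divq_num_den r); by field.
rewrite !expr2 => /(congr1 absz); rewrite !abszM !mulnn /= => e.
have /su d1 : (`|denq r| ^ 2 %| u)%N.
  rewrite -(@Gauss_dvdl _ u (`|numq r| ^ 2)%N); first by rewrite e dvdn_mull.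
  by rewrite coprimeXl // coprimeXr // coprime_sym coprime_num_den.
by have := denq_gt0 r; move: d1; lia.
Qed.

(** Z is integrally closed: the integrality equation of a rational number can be
    read in the field of algebraic numbers, where this is known. *)
Lemma integral_rat_int (F : numFieldType) (r : rat) :
  integralOver (intr : int -> F) (ratr r) -> exists n : int, r = n%:~R.
Proof.
case=> p pm pr.
pose z : algC := ratr r.
have rz : root (map_poly (intr : int -> rat) p) r.
  by rewrite -(fmorph_root (ratr : rat -> F)) -map_poly_comp (eq_map_poly (ratr_int _)).
have : z \is a Num.int.
  apply: Cint_rat_Aint; first exact: Crat_rat.
  apply: (@root_monic_Aint (map_poly intr p)).
  - by rewrite -(eq_map_poly (ratr_int _))
      (map_poly_comp (ratr : rat -> algC)) fmorph_root.
  - exact: monic_map.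
  - by apply/polyOverP => i; rewrite coef_map /= intr_int.
case/intrP => n en; exists n; apply: (fmorph_inj (ratr : rat -> algC)).
by rewrite /= ratr_int -en.
Qed.

(** * Rational combinations of 1, p, q and p q *)

Section Comb.
Variables (R : realType) (u v : nat).
Hypotheses (su : square_free u) (sv : square_free v)
           (u1 : (1 < u)%N) (v1 : (1 < v)%N) (uv : u <> v).

Lemma rational_sqrt_zero (n : nat) (x y : rat) :
  square_free n -> (1 < n)%N -> x ^+ 2 = n%:R * y ^+ 2 -> x = 0 /\ y = 0.
Proof.
move=> sn n1 e; have s1 : square_free 1.
  by move=> d; rewrite dvdn1 -mulnn muln_eq1 => /andP[/eqP].
have := @square_free_square_ratio 1 n x y s1 sn.
by rewrite mulr1 e mulrC => /(_ erefl) [n1'|//]; move: n1; rewrite -n1'.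
Qed.

(** With A = x + y sqrt u and B = z + w sqrt u, the hypotheses say that
    A^2 = v B^2.  Taking norms to Q gives N(A) = v N(B) or N(A) = - v N(B); each
    sign, combined with the first hypothesis, makes v or u v a rational
    square unless the coordinates vanish. *)
Lemma biquadratic_norm_eq0 (x y z w : rat) :
  x ^+ 2 + u%:R * y ^+ 2 = v%:R * (z ^+ 2 + u%:R * w ^+ 2) ->
  x * y = v%:R * (z * w) -> [/\ x = 0, y = 0, z = 0 & w = 0].
Proof.
move=> e1 e2.
have : (x ^+ 2 - u%:R * y ^+ 2 - v%:R * (z ^+ 2 - u%:R * w ^+ 2)) *
       (x ^+ 2 - u%:R * y ^+ 2 + v%:R * (z ^+ 2 - u%:R * w ^+ 2)) = 0.
  transitivity ((x ^+ 2 + u%:R * y ^+ 2) ^+ 2 - 4%:R * u%:R * (x * y) ^+ 2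
     - v%:R ^+ 2 * (z ^+ 2 - u%:R * w ^+ 2) ^+ 2); first by ring.
  by rewrite e1 e2; ring.
move=> /eqP; rewrite mulf_eq0 => /orP[] /eqP e3.
- have [x0 z0] : x = 0 /\ z = 0 by apply: (rational_sqrt_zero sv v1); lra.
  have [y0 w0] : y = 0 /\ w = 0.
    apply: (rational_sqrt_zero sv v1).
    have u0 : u%:R != 0 :> rat by rewrite pnatr_eq0; case: (u) u1.
    apply: (mulfI u0); lra.
  by split.
- have ex : x ^+ 2 * u%:R = (u%:R * w) ^+ 2 * v%:R.
    suff -> : x ^+ 2 = v%:R * (u%:R * w ^+ 2) by ring.
    lra.
  have ey : y ^+ 2 * u%:R = z ^+ 2 * v%:R by lra.
  have [//|[x0 /eqP]] := square_free_square_ratio su sv ex.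
  rewrite mulf_eq0 pnatr_eq0 -leqn0 leqNgt (ltnW u1) /= => /eqP w0.
  by have [//|[y0 z0]] := square_free_square_ratio su sv ey.
Qed.

(** The pair (p, q) is a parameter because the embeddings of Q(sqrt u, sqrt v)
    are obtained by letting it range over the four pairs of square roots of u
    and v, with the rational coordinates unchanged. *)
Definition comb (p q : R) (x y z w : rat) : R :=
  ratr x + ratr y * p + ratr z * q + ratr w * (p * q).

Section Roots.
Variables (p q : R).
Hypotheses (hp : p ^+ 2 = u%:R) (hq : q ^+ 2 = v%:R).

Lemma quad_comb_eq0 (x y : rat) : ratr x + ratr y * p = 0 -> x = 0 /\ y = 0.
Proof.
move=> e; apply: (rational_sqrt_zero su u1).
apply: (fmorph_inj (ratr : rat -> R)).
rewrite !expr2 !rmorphM /= ratr_nat -hp.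
have -> : ratr x = - (ratr y * p) by move/eqP: e; rewrite addr_eq0 => /eqP.
by ring.
Qed.

(** The relative norm to Q(p). *)
Lemma comb_norm (x y z w : rat) :
  comb p q x y z w * comb p (- q) x y z w =
  ratr (x ^+ 2 + u%:R * y ^+ 2 - v%:R * (z ^+ 2 + u%:R * w ^+ 2))
  + ratr (2%:R * (x * y - v%:R * (z * w))) * p.
Proof.
rewrite /comb !expr2 !(rmorphM, rmorphN, rmorphD) /= !ratr_nat rmorph1 -hp -hq.
by ring.
Qed.

Lemma comb_eq0 (x y z w : rat) :
  comb p q x y z w = 0 -> [/\ x = 0, y = 0, z = 0 & w = 0].
Proof.
move=> e; have := comb_norm x y z w; rewrite e mul0r.
by move=> /esym/quad_comb_eq0[eC eD]; apply: biquadratic_norm_eq0; lra.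
Qed.

Lemma combB x y z w x' y' z' w' :
  comb p q x y z w - comb p q x' y' z' w' =
  comb p q (x - x') (y - y') (z - z') (w - w').
Proof. by rewrite /comb !rmorphB /=; ring. Qed.

Lemma comb_inj x y z w x' y' z' w' :
  comb p q x y z w = comb p q x' y' z' w' ->
  [/\ x = x', y = y', z = z' & w = w'].
Proof.
move/eqP; rewrite -subr_eq0 combB => /eqP /comb_eq0[].
by move=> /subr0_eq ? /subr0_eq ? /subr0_eq ? /subr0_eq ?.
Qed.

Lemma combM x y z w x' y' z' w' :
  comb p q x y z w * comb p q x' y' z' w' =
  comb p q (x * x' + u%:R * (y * y') + v%:R * (z * z')
              + u%:R * v%:R * (w * w'))
           (x * y' + y * x' + v%:R * (z * w' + w * z'))
           (x * z' + z * x' + u%:R * (y * w' + w * y'))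
           (x * w' + w * x' + y * z' + z * y').
Proof.
by rewrite /comb !(rmorphM, rmorphD) /= !ratr_nat -hp -hq; ring.
Qed.

(** In A + B q, with A and B in Q(p), the inverse is (A - B q) (C - D p) / N,
    where C + D p = A^2 - v B^2 is the relative norm and N = C^2 - u D^2 the
    norm. *)
Lemma combV x y z w : exists x' y' z' w',
  (comb p q x y z w)^-1 = comb p q x' y' z' w'.
Proof.
have [->|nz] := eqVneq (comb p q x y z w) 0.
  by exists 0, 0, 0, 0; rewrite invr0 /comb rmorph0; ring.
pose C := x ^+ 2 + u%:R * y ^+ 2 - v%:R * (z ^+ 2 + u%:R * w ^+ 2).
pose D := 2%:R * (x * y - v%:R * (z * w)).
pose N := C ^+ 2 - u%:R * D ^+ 2.
have Nnz : N != 0.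
  apply: contra nz; rewrite /N subr_eq0 => /eqP e.
  have [C0 D0] := rational_sqrt_zero su u1 e.
  have [-> -> -> ->] : [/\ x = 0, y = 0, z = 0 & w = 0].
    by apply: biquadratic_norm_eq0; move: C0 D0; rewrite /C /D; lra.
  by rewrite /comb rmorph0 !mul0r !addr0.
exists ((x * C - u%:R * (y * D)) / N), ((y * C - x * D) / N),
  ((u%:R * (w * D) - z * C) / N), ((z * D - w * C) / N).
have NR : ratr N != 0 :> R by rewrite fmorph_eq0.
apply: (mulfI nz); rewrite divff//; symmetry.
rewrite combM /comb.
set c0 := (X in ratr X + _ + _ + _); set c1 := (X in _ + ratr X * p + _ + _).
set c2 := (X in _ + ratr X * q + _); set c3 := (X in _ + ratr X * (p * q)).
have -> : c0 = 1.
  transitivity ((C ^+ 2 - u%:R * D ^+ 2) / N); last exact: divff.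
  by rewrite /c0 /C /D; field.
have -> : c1 = 0 by rewrite /c1 /C /D; field.
have -> : c2 = 0 by rewrite /c2 /C /D; field.
have -> : c3 = 0 by rewrite /c3 /C /D; field.
by rewrite rmorph0 rmorph1; ring.
Qed.

End Roots.
End Comb.

(** * Embeddings of the biquadratic field *)

Section Conj.
Variables (R : realType) (u v : nat).
Hypotheses (su : square_free u) (sv : square_free v)
           (u1 : (1 < u)%N) (v1 : (1 < v)%N) (uv : u <> v).
Variable A : seq R.
Hypotheses (hA : {subset A <= [:: rsqrt R u; rsqrt R v]}).

Lemma sqr_rsqrt n : rsqrt R n ^+ 2 = n%:R.
Proof. by rewrite /rsqrt sqr_sqrtr. Qed.

Local Notation p0 := (rsqrt R u).
Local Notation q0 := (rsqrt R v).
Local Notation K := (Qadj A).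

Lemma subfield_coords (a : R) : a \in subfield_gen A ->
  exists x y z w, a = comb p0 q0 x y z w.
Proof.
move=> /subfield_genP.
pose F : {pred R} := fun r => `[< exists x y z w, r = comb p0 q0 x y z w >].
move=> /(_ F) aF; apply/asboolP; apply: aF.
- split.
  + apply/asboolP; exists 1, 0, 0, 0.
    by rewrite /comb !rmorph0 rmorph1 !mul0r !addr0.
  + move=> _ _ /asboolP[x [y [z [w ->]]]] /asboolP[x' [y' [z' [w' ->]]]].
    by apply/asboolP; rewrite combB; do 4 eexists.
  + move=> _ _ /asboolP[x [y [z [w ->]]]] /asboolP[x' [y' [z' [w' ->]]]].
    apply/asboolP.
    have [x2 [y2 [z2 [w2 ->]]]] :=
      combV su sv u1 v1 uv (sqr_rsqrt u) (sqr_rsqrt v) x' y' z' w'.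
    by rewrite (combM (sqr_rsqrt u) (sqr_rsqrt v)); do 4 eexists.
- move=> r /hA; rewrite !inE => /orP[] /eqP ->; apply/asboolP.
  + by exists 0, 1, 0, 0; rewrite /comb !rmorph0 rmorph1; ring.
  + by exists 0, 0, 1, 0; rewrite /comb !rmorph0 rmorph1; ring.
Qed.

(** The map is well defined by uniqueness of coordinates, and it is a ring
    morphism because the multiplication table of 1, p, q, p q depends only on
    p^2 and q^2. *)
Lemma exists_conjugation (p q : R) : p ^+ 2 = u%:R -> q ^+ 2 = v%:R ->
  exists sigma : {rmorphism K -> R}, forall (a : K) x y z w,
    val a = comb p0 q0 x y z w -> sigma a = comb p q x y z w.
Proof.
move=> hp hq.
have cP (a : K) : {c : rat * rat * rat * rat |
    val a = comb p0 q0 c.1.1.1 c.1.1.2 c.1.2 c.2}.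
  apply: cid; have [x [y [z [w e]]]] := subfield_coords (Qadj_mem a).
  by exists (x, y, z, w).
pose f (a : K) : R := let c := sval (cP a) in comb p q c.1.1.1 c.1.1.2 c.1.2 c.2.
have fE (a : K) x y z w : val a = comb p0 q0 x y z w -> f a = comb p q x y z w.
  rewrite /f; case: (cP a) => c /= -> e.
  by have [-> -> -> ->] := comb_inj su sv u1 v1 uv (sqr_rsqrt u) (sqr_rsqrt v) e.
have fB : zmod_morphism f.
  move=> a b; case: (cP a) (cP b) => [c ea] [d eb].
  rewrite (fE a _ _ _ _ ea) (fE b _ _ _ _ eb) combB; apply: fE.
  by rewrite raddfB /= -combB -ea -eb.
have fM : monoid_morphism f.
  split.
    transitivity (comb p q 1 0 0 0); last first.
      by rewrite /comb !rmorph0 rmorph1 !mul0r !addr0.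
    by apply: fE; rewrite rmorph1 /comb !rmorph0 rmorph1 !mul0r !addr0.
  move=> a b; case: (cP a) (cP b) => [c ea] [d eb].
  rewrite (fE a _ _ _ _ ea) (fE b _ _ _ _ eb) (combM hp hq); apply: fE.
  by rewrite rmorphM -(combM (sqr_rsqrt u) (sqr_rsqrt v)) -ea -eb.
pose fA := GRing.isZmodMorphism.Build K R f fB.
pose fm := GRing.isMonoidMorphism.Build K R f fM.
pose F : {rmorphism K -> R} := HB.pack f fA fm.
by exists F.
Qed.

Lemma integer_of_rmorph (sigma : {rmorphism K -> R}) (a : K) :
  integer_of a -> integralOver (intr : int -> R) (sigma a).
Proof.
move=> /(integral_rmorph sigma) [P mP rP]; exists P => //.
by rewrite -(eq_map_poly (rmorph_int sigma)).
Qed.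
End Conj.

(** * Integer coordinates *)

(** For square-free n this says that (X + Y sqrt n) / 2 is an algebraic integer:
    its trace is X and its norm is N. *)
Definition quad_integer (n : nat) (X Y : int) : Prop :=
  exists N : int, X ^+ 2 - n%:Z * Y ^+ 2 = 4 * N.

Lemma quad_integer_of_integral (R : realType) (n : nat) (p : R) (x y : rat) :
  square_free n -> p ^+ 2 = n%:R ->
  integralOver (intr : int -> R) (ratr x + ratr y * p) ->
  integralOver (intr : int -> R) (ratr x - ratr y * p) ->
  exists X Y : int, [/\ 2%:R * x = X%:~R, 2%:R * y = Y%:~R & quad_integer n X Y].
Proof.
move=> sn hp i1 i2.
have [X eX] : exists X : int, 2%:R * x = X%:~R.
  apply: (@integral_rat_int R); have := integral_add i1 i2.
  by congr integralOver; rewrite rmorphM /= ratr_nat; ring.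
have [N eN] : exists N : int, x ^+ 2 - n%:R * y ^+ 2 = N%:~R.
  apply: (@integral_rat_int R); have := integral_mul i1 i2.
  congr integralOver; rewrite !expr2 !(rmorphM, rmorphB) /= ratr_nat -hp; ring.
have e4 : n%:R * (2%:R * y) ^+ 2 = (X ^+ 2 - 4 * N)%:~R.
  by rewrite !expr2 !(rmorphM, rmorphB) /= -eN -eX; ring.
have [Y eY] := square_free_mul_square_int sn e4.
exists X, Y; split => //; exists N; apply/eqP; rewrite -(eqr_int rat); apply/eqP.
move: e4; rewrite eY !expr2 !(rmorphM, rmorphB) /= => ->; ring.
Qed.

Section Coords.
Variables (R : realType) (g a b : nat).
Local Notation u := (g * a)%N.
Local Notation v := (g * b)%N.
Local Notation w := (a * b)%N.

(** The root of a b replaces the product of the other two roots, which is g times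
    larger, so that all coordinates below become integers. *)
Definition int_comb (X Y Z W : int) : R :=
  X%:~R + Y%:~R * rsqrt R u + Z%:~R * rsqrt R v + W%:~R * rsqrt R w.

(** Necessary conditions for the integrality of a quarter of int_comb X Y Z W.
    The first three come from its traces to the three quadratic subfields; the
    last one from its norm to Q(sqrt u), which is (P + Q sqrt u) / 2. *)
Definition integral_coords (X Y Z W : int) : Prop :=
  [/\ quad_integer u X Y, quad_integer v X Z, quad_integer w X W &
      exists P Q : int,
        [/\ 8 * P = X ^+ 2 + u%:Z * Y ^+ 2 - v%:Z * Z ^+ 2 - w%:Z * W ^+ 2,
            4 * Q = X * Y - b%:Z * (Z * W) & quad_integer u P Q]].

(** The sign of the root of w is the product of the signs of the roots of u
    and v. *)
Definition positive_coords (X Y Z W : int) : Prop :=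
  [/\ 0 < int_comb X Y Z W, 0 < int_comb X Y (- Z) (- W),
      0 < int_comb X (- Y) Z (- W) & 0 < int_comb X (- Y) (- Z) W].

Lemma rsqrtM_common : rsqrt R u * rsqrt R v = g%:R * rsqrt R w.
Proof.
have -> : g%:R = Num.sqrt (g%:R ^+ 2) :> R by rewrite sqrtr_sqr ger0_norm.
rewrite /rsqrt -!sqrtrM ?exprn_ge0// -!natrX -!natrM.
by congr (Num.sqrt _%:R); ring.
Qed.

Hypotheses (su : square_free u) (sv : square_free v) (sw : square_free w)
           (u1 : (1 < u)%N) (v1 : (1 < v)%N) (uv : u <> v).

Lemma g_neq0 : g%:R != 0 :> rat.
Proof. by rewrite pnatr_eq0; move: u1; case: (g). Qed.

Lemma int_combE X Y Z W :
  int_comb X Y Z W =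
  comb (rsqrt R u) (rsqrt R v) X%:~R Y%:~R Z%:~R (W%:~R / g%:R).
Proof.
rewrite /int_comb /comb !ratr_int rmorphM fmorphV /= ratr_int ratr_nat.
rewrite rsqrtM_common.
have : g%:R != 0 :> R by rewrite pnatr_eq0; move: u1; case: (g).
by move=> g0; field.
Qed.

Lemma int_comb_inj X Y Z W X' Y' Z' W' :
  int_comb X Y Z W = int_comb X' Y' Z' W' ->
  [/\ X = X', Y = Y', Z = Z' & W = W'].
Proof.
rewrite !int_combE => /(comb_inj su sv u1 v1 uv (sqr_rsqrt R u) (sqr_rsqrt R v)).
case=> /intr_inj -> /intr_inj -> /intr_inj ->.
by move=> /(mulIf (invr_neq0 g_neq0)) /intr_inj ->.
Qed.

(** The traces and the norm of c to a quadratic subfield are sums and products of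
    two conjugates, hence integral; so are their own conjugates, and
    quad_integer_of_integral applies. *)
Lemma OKplus_coords (A : seq R) (hA : {subset A <= [:: rsqrt R u; rsqrt R v]})
    (c : Qadj A) : OKplus R c ->
  exists X Y Z W : int, [/\ 4%:R * val c = int_comb X Y Z W,
    integral_coords X Y Z W & positive_coords X Y Z W].
Proof.
move=> [ic pc].
set p := rsqrt R u; set q := rsqrt R v; set r := rsqrt R w.
have hp : p ^+ 2 = u%:R by exact: sqr_rsqrt.
have hq : q ^+ 2 = v%:R by exact: sqr_rsqrt.
have hr : r ^+ 2 = w%:R by exact: sqr_rsqrt.
have hpq : p * q = g%:R * r by exact: rsqrtM_common.
have [x [y [z [t ec]]]] := subfield_coords su sv u1 v1 uv hA (Qadj_mem c).
have conj p' q' : p' ^+ 2 = u%:R -> q' ^+ 2 = v%:R ->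
    integralOver (intr : int -> R) (comb p' q' x y z t) /\ 0 < comb p' q' x y z t.
  move=> hp' hq'.
  have [sigma sE] := exists_conjugation su sv u1 v1 uv hA hp' hq'.
  rewrite -(sE c x y z t ec); split; last exact: pc.
  exact: integer_of_rmorph.
have hNp : (- p) ^+ 2 = u%:R by rewrite sqrrN.
have hNq : (- q) ^+ 2 = v%:R by rewrite sqrrN.
(* The index i of i1, c1 and the like numbers the embeddings: (p, q), (p, -q),
   (-p, q) and (-p, -q). *)
have [i1 c1] := conj _ _ hp hq; have [i2 c2] := conj _ _ hp hNq.
have [i3 c3] := conj _ _ hNp hq; have [i4 c4] := conj _ _ hNp hNq.
have [X [Y [eX eY iu]]] : exists X Y : int,
    [/\ 2%:R * (2%:R * x) = X%:~R, 2%:R * (2%:R * y) = Y%:~R & quad_integer u X Y].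
  apply: (quad_integer_of_integral su hp).
  - by have := integral_add i1 i2; congr integralOver;
      rewrite /comb !rmorphM /= !ratr_nat; ring.
  - by have := integral_add i3 i4; congr integralOver;
      rewrite /comb !rmorphM /= !ratr_nat; ring.
have [X' [Z [eX' eZ iv]]] : exists X Y : int,
    [/\ 2%:R * (2%:R * x) = X%:~R, 2%:R * (2%:R * z) = Y%:~R & quad_integer v X Y].
  apply: (quad_integer_of_integral sv hq).
  - by have := integral_add i1 i3; congr integralOver;
      rewrite /comb !rmorphM /= !ratr_nat; ring.
  - by have := integral_add i2 i4; congr integralOver;
      rewrite /comb !rmorphM /= !ratr_nat; ring.
have [X'' [W [eX'' eW iw]]] : exists X Y : int,
    [/\ 2%:R * (2%:R * x) = X%:~R, 2%:R * (2%:R * t * g%:R) = Y%:~R & quad_integer w X Y].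
  apply: (quad_integer_of_integral sw hr).
  - have := integral_add i1 i4; congr integralOver.
    by rewrite /comb mulrNN hpq !rmorphM /= !ratr_nat; ring.
  - have := integral_add i2 i3; congr integralOver.
    by rewrite /comb (mulrN p) (mulNr p) hpq !rmorphM /= !ratr_nat; ring.
have {X' eX' iv} iv : quad_integer v X Z.
  by move: iv; rewrite (_ : X' = X)//; apply: (@intr_inj rat); rewrite -eX.
have {X'' eX'' iw} iw : quad_integer w X W.
  by move: iw; rewrite (_ : X'' = X)//; apply: (@intr_inj rat); rewrite -eX.
have [P [Q [eP eQ iPQ]]] : exists P Q : int,
    [/\ 2%:R * (x ^+ 2 + u%:R * y ^+ 2 - v%:R * (z ^+ 2 + u%:R * t ^+ 2)) = P%:~R,
        2%:R * (2%:R * (x * y - v%:R * (z * t))) = Q%:~R & quad_integer u P Q].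
  apply: (quad_integer_of_integral su hp).
  - by have := integral_mul i1 i2; rewrite (comb_norm hp hq).
  - by have := integral_mul i3 i4; rewrite (comb_norm hNp hq) mulrN.
have eW' : W%:~R / g%:R = 4%:R * t :> rat.
  by rewrite -eW !mulrA mulfK ?g_neq0//; ring.
have eX' : X%:~R = 4%:R * x :> rat by rewrite -eX; ring.
have eY' : Y%:~R = 4%:R * y :> rat by rewrite -eY; ring.
have eZ' : Z%:~R = 4%:R * z :> rat by rewrite -eZ; ring.
have scaled (p' q' : R) (sp sq : int) : sp%:~R * p = p' -> sq%:~R * q = q' ->
    int_comb X (sp * Y) (sq * Z) (sp * sq * W) = 4%:R * comb p' q' x y z t.
  move=> <- <-; rewrite int_combE -/p -/q /comb !intrM -(mulrA (_ * _) W%:~R).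
  rewrite eX' eY' eZ' eW' !rmorphM /= !ratr_nat !ratr_int; ring.
exists X, Y, Z, W; split.
- have := scaled p q 1 1 (mul1r _) (mul1r _); rewrite !mul1r => ->.
  by congr (_ * _); exact: ec.
- split => //; exists P, Q; split => //.
  + apply/eqP; rewrite -(eqr_int rat); apply/eqP.
    rewrite !expr2 !(rmorphM, rmorphN, rmorphD) /= -eP eX' eY' eZ' -eW.
    rewrite -!pmulrn !natrM; ring.
  + apply/eqP; rewrite -(eqr_int rat); apply/eqP.
    rewrite !(rmorphM, rmorphN, rmorphD) /= -eQ eX' eY' eZ' -eW.
    by rewrite -!pmulrn !natrM; ring.
- split.
  + have := scaled p q 1 1 (mul1r _) (mul1r _); rewrite !mul1r => ->.
    by rewrite mulr_gt0.
  + have := scaled p (- q) 1 (- 1) (mul1r _) (mulN1r _); rewrite !mul1r !mulN1r => ->.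
    by rewrite mulr_gt0.
  + have := scaled (- p) q (- 1) 1 (mulN1r _) (mul1r _); rewrite !mulr1 !mul1r !mulN1r => ->.
    by rewrite mulr_gt0.
  + have := scaled (- p) (- q) (- 1) (- 1) (mulN1r _) (mulN1r _).
    by rewrite mulrNN mulr1 mul1r !mulN1r => ->; rewrite mulr_gt0.
Qed.
End Coords.

(** * Parities and sizes of coordinates *)

Lemma intz_parity (x : int) : exists y : int, x = 2 * y \/ x = 2 * y + 1.
Proof. by exists (x %/ 2)%Z; lia. Qed.

Lemma nat_mod4 (n : nat) : exists m : int,
  [\/ n%:Z = 4 * m, n%:Z = 4 * m + 1, n%:Z = 4 * m + 2 | n%:Z = 4 * m + 3].
Proof.
exists (n %/ 4)%N; have := ltn_pmod n (isT : (0 < 4)%N); have := divn_eq n 4.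
case: (n %% 4)%N => [|[|[|[|//]]]] e _;
  [constructor 1|constructor 2|constructor 3|constructor 4]; lia.
Qed.

Lemma square_free_mod4 n : square_free n -> forall m : int, n%:Z <> 4 * m.
Proof.
move=> sn m e; have := sn 2; rewrite (_ : (2 ^ 2 %| n)%N) => [/(_ isT)//|].
by apply/dvdnP; exists `|m|%N; lia.
Qed.

Lemma quad_integer_even n (X Z : int) : square_free n ->
  quad_integer n (2 * X) Z -> exists c, Z = 2 * c.
Proof.
move=> sn [N e]; have [c [->|Zo]] := intz_parity Z; first by exists c.
case: (square_free_mod4 sn (m := X ^+ 2 - N - n%:Z * (c ^+ 2 + c))).
move: e; rewrite Zo !expr2; lia.
Qed.

(** An odd X occurs only when n = 1 mod 4, where half-integers are allowed. *)
Lemma quad_integer_odd n (X Z : int) : quad_integer n (2 * X + 1) Z ->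
  exists c m, Z = 2 * c + 1 /\ n%:Z = 4 * m + 1.
Proof.
move=> [N e]; have [c [Ze|Ze]] := intz_parity Z; move: e; rewrite Ze.
  by rewrite !expr2; lia.
exists c; exists (X ^+ 2 + X - N - n%:Z * (c ^+ 2 + c)); split => //.
by move: e; rewrite !expr2; lia.
Qed.

Lemma lt_sqrt_int (R : realType) (n : nat) (Y X : int) :
  - X%:~R < Y%:~R * rsqrt R n < X%:~R -> 0 < X /\ n%:Z * Y ^+ 2 < X ^+ 2.
Proof.
rewrite -ltr_norml => lt.
have X0 : 0 < X%:~R :> R by apply: le_lt_trans lt.
split; first by rewrite -(ltr0z R).
rewrite -(ltr_int R) !(rmorphM, rmorphXn) /= -!pmulrn -(sqr_rsqrt R n) -exprMn mulrC.
by rewrite -real_normK ?num_real// ltr_pXn2r ?nnegrE ?normr_ge0 ?(ltW X0).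
Qed.

Section Bounds.
Variables (R : realType) (g a b : nat).
Local Notation u := (g * a)%N.
Local Notation v := (g * b)%N.
Local Notation w := (a * b)%N.
Variables (X Y Z W : int).
Hypothesis pos : positive_coords R g a b X Y Z W.

Lemma positive_bounds :
  [/\ 0 < X, u%:Z * Y ^+ 2 < X ^+ 2, v%:Z * Z ^+ 2 < X ^+ 2
    & w%:Z * W ^+ 2 < X ^+ 2].
Proof.
move: pos; rewrite /positive_coords /int_comb !rmorphN /= => -[h1 h2 h3 h4].
have [] := @lt_sqrt_int R u Y X; first by apply/andP; split; lra.
have [] := @lt_sqrt_int R v Z X; first by apply/andP; split; lra.
have [] := @lt_sqrt_int R w W X; first by apply/andP; split; lra.
by [].
Qed.

(** The right-hand side is a conjugate of the trace to Q(sqrt u), up to a factor;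
    for the traces of interest it is small, so the other two terms nearly
    cancel. *)
Lemma positive_gap :
  - (X%:~R - Y%:~R * rsqrt R u) < Z%:~R * rsqrt R v - W%:~R * rsqrt R w
  < X%:~R - Y%:~R * rsqrt R u.
Proof.
move: pos; rewrite /positive_coords /int_comb !rmorphN /= => -[h1 h2 h3 h4].
by apply/andP; split; lra.
Qed.
End Bounds.

Lemma rsqrt_ge0 (R : realType) n : 0 <= rsqrt R n.
Proof. exact: sqrtr_ge0. Qed.

Lemma rsqrt_lt (R : realType) m n : (rsqrt R m < rsqrt R n) = (m < n)%N.
Proof.
rewrite -(@ltr_pXn2r _ 2)// ?nnegrE ?rsqrt_ge0//.
by rewrite !sqr_rsqrt ltr_nat.
Qed.

Lemma int_lt_rsqrt (R : realType) (k : int) n :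
  0 <= k -> k ^+ 2 < n%:Z -> k%:~R < rsqrt R n.
Proof.
move=> k0 lt; rewrite -(@ltr_pXn2r _ 2)// ?nnegrE ?rsqrt_ge0 ?ler0z//.
by rewrite sqr_rsqrt pmulrn -rmorphXn /= ltr_int.
Qed.

Lemma rsqrt_lt_int (R : realType) (k : int) n :
  0 <= k -> n%:Z < k ^+ 2 -> rsqrt R n < k%:~R.
Proof.
move=> k0 lt; rewrite -(@ltr_pXn2r _ 2)// ?nnegrE ?rsqrt_ge0 ?ler0z//.
by rewrite sqr_rsqrt pmulrn -rmorphXn /= ltr_int.
Qed.

(** * Traces that do not occur *)

Lemma sqr_ge1 (x : int) : x <> 0 -> 1 <= x ^+ 2.
Proof. by rewrite expr2; nia. Qed.

Lemma ltz_sqr (x y : int) : 0 <= y -> x ^+ 2 < y ^+ 2 -> x < y.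
Proof. by rewrite !expr2; nia. Qed.

Lemma sqr_unit_or_ge4 (d : int) : d <> 0 -> d ^+ 2 = 1 \/ 4 <= d ^+ 2.
Proof.
move=> d0; have [->|n1] := eqVneq d 1; first by left.
have [->|n2] := eqVneq d (- 1); first by left.
by right; rewrite expr2; nia.
Qed.

Lemma lez_pmul (x y z : int) : 0 <= x -> y <= z -> x * y <= x * z.
Proof. by move=> *; rewrite ler_wpM2l. Qed.

(** The congruences modulo 4 in the extremal case b = g + 1 of
    no_trace_calU_mod23.  As g (g + 1) is square-free, g is 1 or 2 modulo 4.  In
    the first case P^2 = u Q^2 modulo 4 with Q odd gives u = 1 modulo 4, which
    is excluded.  In the second case u is 2 modulo 4, so P and Q are even, and
    this makes c odd and a = 3 = g + 1 modulo 4. *)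
Lemma consecutive_parity (g a : nat) (k c d P Q : int) :
  square_free (g * a) -> square_free (g * g.+1) -> square_free (a * g.+1) ->
  (forall m : int, (g * a)%N%:Z <> 4 * m + 1) -> (g.+1 < a)%N ->
  2 * P = k ^+ 2 - (g * g.+1)%N%:Z * c ^+ 2 - a%:Z ->
  Q = k - g.+1%:Z * (c * d) -> quad_integer (g * a) P Q ->
  (exists e, c = 2 * e + 1) /\ g.+1%:Z + 4 <= a%:Z.
Proof.
move=> su sv sw u1 lt_a eP eQ [N eN].
have uE : (g * a)%N%:Z = g%:Z * a%:Z by [].
have vE : (g * g.+1)%N%:Z = g%:Z * (g%:Z + 1) by rewrite -addn1.
have wE : (a * g.+1)%N%:Z = a%:Z * (g%:Z + 1) by rewrite -addn1.
have bE : g.+1%:Z = g%:Z + 1 by rewrite -addn1.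
have a_odd : exists l, a%:Z = 2 * l + 1.
  have [l [al|al]] := intz_parity a%:Z; last by exists l.
  have [m [e|e|e|e]] := nat_mod4 g.
  - case: (square_free_mod4 su (m := m * a%:Z)).
    by rewrite uE e; clear; lia.
  - case: (square_free_mod4 sw (m := l * (2 * m + 1))).
    by rewrite wE e al; clear; lia.
  - case: (square_free_mod4 su (m := l * (2 * m + 1))).
    by rewrite uE e al; clear; lia.
  - case: (square_free_mod4 sv (m := g%:Z * (m + 1))).
    by rewrite vE e; clear; lia.
have [l al] := a_odd.
have [i ki] : exists i, k = 2 * i + 1.
  have [i [ki|]] := intz_parity k; last by exists i.
  exfalso; have [j [gj|gj]] := intz_parity g%:Z;
    by move: eP; rewrite vE al ki gj !expr2; clear; lia.
have [m [e|e|e|e]] := nat_mod4 g.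
- case: (square_free_mod4 su (m := m * a%:Z)).
  by rewrite uE e; clear; lia.
- have [j Qj] : exists j, Q = 2 * j + 1.
    exists (i - (2 * m + 1) * (c * d)).
    by rewrite eQ bE ki e; clear; lia.
  have [p [Pp|Pp]] := intz_parity P.
    exfalso; move: eN; rewrite uE Pp Qj e al !expr2; clear; lia.
  exfalso; apply: (u1 (p ^+ 2 + p - N - (g * a)%N%:Z * (j ^+ 2 + j))).
  by move: eN; rewrite Pp Qj; move: (Posz (g * a)) => U; rewrite !expr2; clear; lia.
- have [p Pp] : exists p, P = 2 * p.
    have [p [Pp|Pp]] := intz_parity P; first by exists p.
    exfalso; move: eN; rewrite uE Pp e !expr2; clear; lia.
  have [j Qj] : exists j, Q = 2 * j.
    have [j [Qj|Qj]] := intz_parity Q; first by exists j.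
    exfalso; move: eN; rewrite uE Pp Qj e al !expr2; clear; lia.
  have [f cf] : exists f, c = 2 * f + 1.
    have [f [cf|cf]] := intz_parity c; last by exists f.
    exfalso; move: eQ; rewrite bE Qj ki cf; move: (g%:Z) => G; clear; lia.
  split; first by exists f.
  have [t at'] : exists t, a%:Z = 4 * t + 3.
    exists (i ^+ 2 + i - p - 1 - (4 * m ^+ 2 + 5 * m + 1) * c ^+ 2 - 2 * (f ^+ 2 + f)).
    by move: eP; rewrite Pp vE ki cf e !expr2; clear; lia.
  move: lt_a; rewrite -ltz_nat bE at' e; clear; lia.
- case: (square_free_mod4 sv (m := g%:Z * (m + 1))).
  by rewrite vE e; clear; lia.
Qed.

Section Trace.
Variables (R : realType) (g a b : nat).
Local Notation u := (g * a)%N.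
Local Notation v := (g * b)%N.
Local Notation w := (a * b)%N.
Hypotheses (su : square_free u) (sv : square_free v) (sw : square_free w).

Lemma small_even_zero n (X Z : int) : square_free n ->
  quad_integer n (2 * X) Z -> n%:Z * Z ^+ 2 < 4 -> Z = 0.
Proof.
move=> sn /(quad_integer_even sn)[c ->]; have n0 := square_free_gt0 sn.
have [->|/eqP/sqr_ge1] := eqVneq c 0; first by rewrite mulr0.
rewrite !expr2; nia.
Qed.

(** An element of trace 1 would be 1/2: the bounds leave no room for nonzero even
    Z and W. *)
Lemma no_trace_one Z W :
  integral_coords g a b 2 0 Z W -> positive_coords R g a b 2 0 Z W -> False.
Proof.
move=> [_ iv iw [P [Q [eP _ _]]]] /positive_bounds[_ _ bv bw].
have Z0 : Z = 0 by apply: (@small_even_zero v 1); rewrite ?mulr1.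
have W0 : W = 0 by apply: (@small_even_zero w 1); rewrite ?mulr1.
by move: eP; rewrite Z0 W0 !expr2; lia.
Qed.

Section Mod23.
Hypotheses (u1 : forall m : int, u%:Z <> 4 * m + 1).
Variables (k : int).
Hypotheses (k2 : 2 <= k) (lu : (k - 1) ^+ 2 < u%:Z).
Hypotheses (ga : (g < a)%N) (gb : (g < b)%N) (ab : a <> b).

(** Here U = k + sqrt u, and c, d denote Z / 2, W / 2.  If d = 0 then c = 0 and
    U / 2 would be integral.  Otherwise d^2 = 1, so u and w both lie strictly
    between (k - 1)^2 and k^2; as w - u = a (b - g) and a >= k, this leaves only
    b = g + 1, hence v < u.  The congruences give c odd and a >= b + 4.  The
    sizes then give k <= 2 g and c^2 = 1.  Now the gap bound reads
    sqrt u - sqrt v < k - sqrt w < 1, whereas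
    u - v = g (a - b) >= 4 g >= 2 k > sqrt u + sqrt v. *)
Lemma no_trace_calU_mod23 Z W : u%:Z < k ^+ 2 ->
  integral_coords g a b (2 * k) 2 Z W ->
  positive_coords R g a b (2 * k) 2 Z W -> False.
Proof.
move=> hu [_ iv iw [P [Q [eP eQ [N eN]]]]] pos.
have [_ _ bv bw] := positive_bounds pos.
have gap := positive_gap pos.
have [c Ze] := quad_integer_even sv iv; have [d We] := quad_integer_even sw iw.
have ltku : (k - 1)%:~R < rsqrt R u.
  by apply: int_lt_rsqrt => //; lia.
have [d0|/eqP dn0] := eqVneq d 0.
  have Z0 : Z = 0.
    apply: (small_even_zero sv iv).
    have [|_ h2] := @lt_sqrt_int R v Z 2; last by move: h2; rewrite [2 ^+ 2]expr2.
    move: gap; rewrite We d0 mulr0 mul0r subr0 => /andP[].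
    move: ltku; rewrite !(rmorphM, rmorphB) /= => h1 h2 h3.
    by apply/andP; split; lra.
  move: eP eQ; rewrite We d0 Z0 !expr2 => eP eQ.
  have {eQ} Qk : Q = k by lia.
  have [m [e|e|e|e]] := nat_mod4 u.
  - exact: square_free_mod4 su _ e.
  - exact: u1 e.
  - have [l [lk|lk]] := intz_parity k.
    + have [P' eP'] : exists P', P = 2 * P' + 1.
        by exists (l ^+ 2 + m); move: eP; rewrite lk e !expr2; lia.
      by move: eN; rewrite eP' Qk lk !expr2; lia.
    + by move: eP; rewrite lk e; lia.
  - have [l [lk|lk]] := intz_parity k.
    + by move: eP; rewrite lk e; lia.
    + have [P' eP'] : exists P', P = 2 * P'.
        by exists (l ^+ 2 + l + m + 1); move: eP; rewrite lk e !expr2; lia.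
      by move: eN; rewrite eP' Qk lk e !expr2; lia.
have w1 : w%:Z * d ^+ 2 < k ^+ 2 by move: bw; rewrite We !expr2; lia.
have uw : u%:Z < w%:Z.
  by rewrite ltz_nat mulnC ltn_mul2l gb (leq_ltn_trans _ ga).
have d1 : d ^+ 2 = 1.
  have [//|/(lez_pmul (isT : 0 <= w%:Z))] := sqr_unit_or_ge4 dn0.
  have k0 : 0 <= k - 2 by move: k2; clear; lia.
  by have := mulr_ge0 k0 k0; move: w1 lu; rewrite !expr2; lia.
rewrite d1 mulr1 in w1.
have ak : k <= a%:Z.
  suff : k - 1 < a%:Z by lia.
  apply: ltz_sqr => //; apply: (lt_le_trans lu).
  by rewrite expr2 -PoszM lez_nat leq_mul2r ltnW ?orbT.
have bg : b = g.+1.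
  have [//|] := eqVneq b g.+1; rewrite neq_ltn ltnNge gb /= => gb2.
  have /(lez_pmul (isT : 0 <= a%:Z)) : (g.+2)%:Z <= b%:Z by rewrite lez_nat.
  by move: w1 lu; rewrite !expr2; lia.
have ba : (b < a)%N by move: ab ga; rewrite bg; lia.
have wu : w%:Z - u%:Z = a%:Z by rewrite bg; lia.
have eP2 : 2 * P = k ^+ 2 - v%:Z * c ^+ 2 - a%:Z.
  have dd : d * d = 1 by rewrite -expr2.
  move: eP; rewrite Ze We !expr2.
  have -> : w%:Z * (2 * d * (2 * d)) = 4 * w%:Z * (d * d) by ring.
  by rewrite dd; move: wu; clear; lia.
have eQ2 : Q = k - b%:Z * (c * d) by move: eQ; rewrite Ze We; clear; lia.
have [c_odd ab4] : (exists e, c = 2 * e + 1) /\ b%:Z + 4 <= a%:Z.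
  by have := @consecutive_parity g a k c d P Q; rewrite -bg; apply => //; exists N.
(* a^2 <= 4 (k - 1)^2 < 4 u = 4 g a *)
have ag : a%:Z < 4 * g%:Z.
  have a0 : 0 < a%:Z by rewrite ltz_nat (leq_ltn_trans _ ga).
  rewrite -(ltr_pM2r a0).
  have : a%:Z <= 2 * (k - 1) by move: w1 lu wu; clear; rewrite !expr2; lia.
  move=> h; have := ler_pM (isT : 0 <= a%:Z) (isT : 0 <= a%:Z) h h.
  by move: lu; clear; rewrite !expr2; lia.
(* (k - 1)^2 < g a < 4 g^2 *)
have kg : k <= 2 * g%:Z.
  suff : k - 1 < 2 * g%:Z by clear; lia.
  apply: ltz_sqr; first by clear; lia.
  apply: (lt_trans lu); rewrite PoszM expr2.
  have g0 : 0 < g%:Z by move: ag; clear; lia.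
  by move: ag; rewrite -(ltr_pM2l g0); clear; lia.
(* Otherwise v c^2 >= 4 g (g + 1) > k^2. *)
have c1 : c ^+ 2 = 1.
  have [|//|] := @sqr_unit_or_ge4 c.
    by case: c_odd => e ->; clear; lia.
  move=> /(lez_pmul (isT : 0 <= v%:Z)).
  have k0 : 0 <= k by move: k2; clear; lia.
  have := ler_pM k0 k0 kg kg; move: bv k2; rewrite Ze bg !expr2; clear; lia.
have cd : c = d \/ c = - d.
  have : (c - d) * (c + d) = 0 by move: c1 d1; clear; rewrite !expr2; lia.
  move=> /eqP; rewrite mulf_eq0 => /orP[] /eqP h; [left|right]; move: h; clear; lia.
set U := rsqrt R u in gap ltku; set V := rsqrt R v in gap; set T := rsqrt R w in gap.
have UT : U < T by rewrite rsqrt_lt -ltz_nat.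
have VU : V < U by rewrite rsqrt_lt ltn_pmul2l//; move: kg k2; clear; lia.
have Uk : U < k%:~R by apply: rsqrt_lt_int => //; move: k2; clear; lia.
have V0 : 0 <= V by exact: rsqrt_ge0.
have k2R : 2%:R <= k%:~R :> R by rewrite -[2%:R]/((2%:Z)%:~R) ler_int.
have UV : 2 * k%:~R <= U ^+ 2 - V ^+ 2.
  rewrite !sqr_rsqrt !pmulrn -rmorphB -(intrM _ 2) ler_int.
  have g0 : 0 <= g%:Z by [].
  by have := lez_pmul g0 ab4; rewrite bg; move: kg; clear; lia.
have dR : d = 1 \/ d = - 1.
  have : (d - 1) * (d + 1) = 0 by move: d1; clear; rewrite !expr2; lia.
  move=> /eqP; rewrite mulf_eq0 => /orP[] /eqP h; [left|right]; move: h; clear; lia.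
have ltk : k%:~R - 1 < U by move: ltku; rewrite rmorphB.
have TV : T - V < k%:~R - U.
  move: gap; rewrite Ze We !rmorphM /=.
  by case: cd => ->; case: dR => ->; rewrite ?rmorphN ?opprK /= => /andP[]; lra.
have : (U - V) * (U + V) < 1 * (2 * k%:~R) by nra.
nra.
Qed.
End Mod23.
End Trace.

Lemma sqr_unit_or_two_or_ge9 (d : int) :
  d <> 0 -> [\/ d ^+ 2 = 1, d ^+ 2 = 4 | 9 <= d ^+ 2].
Proof.
move=> d0; have [->|n1] := eqVneq d 1; first by constructor 1.
have [->|n2] := eqVneq d (- 1); first by constructor 1.
have [->|n3] := eqVneq d 2; first by constructor 2.
have [->|n4] := eqVneq d (- 2); first by constructor 2.
by constructor 3; rewrite expr2; nia.
Qed.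

(** The product a (b - g) is a multiple of 4 and a is odd. *)
Lemma mod4_gap (g a b : nat) (m m' : int) :
  (g * a)%N%:Z = 4 * m + 1 -> (a * b)%N%:Z = 4 * m' + 1 -> (g < b)%N ->
  g%:Z + 4 <= b%:Z.
Proof.
rewrite !PoszM -ltz_nat => e1 e2.
have [x ex] : exists x, a%:Z * (b%:Z - g%:Z) = 4 * x.
  by exists (m' - m); move: e1 e2; clear; lia.
have [l [al|al]] := intz_parity a%:Z; first by move: e1; rewrite al; clear; lia.
have [y ey] : exists y, b%:Z - g%:Z = 2 * y.
  have [y [?|ey]] := intz_parity (b%:Z - g%:Z); first by exists y.
  by move: ex; rewrite al ey; clear; lia.
have [z ez] : exists z, y = 2 * z.
  have [z [?|ez]] := intz_parity y; first by exists z.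
  by move: ex; rewrite al ey ez; clear; lia.
move: ey; rewrite ez; clear; lia.
Qed.

Section Gaps.
Variables (R : realType) (g a b : nat).
Local Notation u := (g * a)%N.
Local Notation v := (g * b)%N.
Local Notation w := (a * b)%N.
Hypotheses (su : square_free u) (sv : square_free v) (sw : square_free w).
Hypotheses (ga : (g < a)%N) (gb : (g < b)%N).

(** As g < a, the square of a exceeds u. *)
Lemma ltz_factor (j : int) : j ^+ 2 < u%:Z -> j < a%:Z.
Proof.
move=> lt; apply: ltz_sqr => //; apply: (lt_le_trans lt).
by rewrite expr2 -PoszM lez_nat leq_mul2r ltnW ?orbT.
Qed.

Lemma gap_uw (e : nat) : (g + e <= b)%N -> u%:Z + a%:Z * e%:Z <= w%:Z.
Proof.
rewrite -lez_nat => /(lez_pmul (isT : 0 <= a%:Z)); rewrite !PoszM PoszD.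
by clear; lia.
Qed.

(** Here U = (k + sqrt u) / 2 with k odd, so Z and W are odd and w lies, like u,
    between (k - 2)^2 and k^2.  All three radicands are 1 modulo 4, hence
    b >= g + 4 and w - u >= 4 a >= 4 (k - 1): this is the full length of the
    interval. *)
Lemma no_trace_calU_mod1 (k j Z W : int) (m : int) : u%:Z = 4 * m + 1 ->
  0 < k -> k = 2 * j + 1 -> (k - 2) ^+ 2 < u%:Z ->
  integral_coords g a b k 1 Z W -> positive_coords R g a b k 1 Z W -> False.
Proof.
move=> um k0 kj lu [_ iv iw _] /positive_bounds[_ _ bv bw].
rewrite kj in iv iw.
have [d [m' [We wm]]] := quad_integer_odd iw.
have W1 : 1 <= W ^+ 2 by apply: sqr_ge1; rewrite We; clear; lia.
have := lez_pmul (isT : 0 <= w%:Z) W1; rewrite mulr1 => wW.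
have gb4 := mod4_gap um wm gb.
have := @gap_uw 4; rewrite -lez_nat PoszD => /(_ gb4).
have := ltz_factor lu; move: lu bw wW k0; rewrite !expr2.
by move: (u%:Z) (w%:Z) (a%:Z) => U T A; clear; lia.
Qed.

(** With q = 2 k - 1 one has 2 U - 1 = q + 2 sqrt u, and 4 u lies between
    (q - 1)^2 and q^2.  Again c = Z / 2 and d = W / 2 are nonzero, and d^2 = 1
    because 4 w < q^2 is incompatible with b >= g + 2.  The three possible sizes
    of c fail for different reasons: c^2 = 1 by congruences modulo 4; c^2 = 4
    because w is then odd, so b >= a + 2 and 4 v - 4 u >= 8 g is longer than the
    interval; c^2 >= 9 because v > u. *)
Lemma no_trace_twice_mod23 (q i Z W : int) : 3 <= q -> q = 2 * i + 1 -> (a < b)%N ->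
  (q - 1) ^+ 2 < 4 * u%:Z ->
  integral_coords g a b (2 * q) 4 Z W ->
  positive_coords R g a b (2 * q) 4 Z W -> False.
Proof.
move=> q3 qi ab lu [_ iv iw [P [Q [eP eQ [N eN]]]]] pos.
have [_ bu bv bw] := positive_bounds pos.
have gap := positive_gap pos.
have [c Ze] := quad_integer_even sv iv; have [d We] := quad_integer_even sw iw.
have ltq : (q - 1)%:~R < 2 * rsqrt R u.
  have : i%:~R < rsqrt R u.
    apply: int_lt_rsqrt; first by move: q3; rewrite qi; clear; lia.
    by move: lu; rewrite qi !expr2; clear; lia.
  rewrite qi addrK rmorphM /=; lra.
have [d0|/eqP dn0] := eqVneq d 0.
  have Z0 : Z = 0.
    apply: (small_even_zero sv iv).
    have [|_ h2] := @lt_sqrt_int R v Z 2; last by move: h2; rewrite [2 ^+ 2]expr2.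
    move: gap; rewrite We d0 mulr0 mul0r subr0 => /andP[].
    move: ltq; rewrite !(rmorphM, rmorphB) /= => h1 h2 h3.
    by apply/andP; split; lra.
  by move: eP; rewrite We d0 Z0 qi !expr2; clear; lia.
have [c0|/eqP cn0] := eqVneq c 0.
  have W0 : W = 0.
    apply: (small_even_zero sw iw).
    have [|_ h2] := @lt_sqrt_int R w W 2; last by move: h2; rewrite [2 ^+ 2]expr2.
    move: gap; rewrite Ze c0 mulr0 mul0r sub0r => /andP[].
    move: ltq; rewrite !(rmorphM, rmorphB) /= => h1 h2 h3.
    by apply/andP; split; lra.
  by move: W0; rewrite We => /eqP; rewrite mulf_eq0 /= => /eqP.
have bw' : w%:Z * d ^+ 2 < q ^+ 2 by move: bw; rewrite We !expr2; clear; lia.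
have bv' : v%:Z * c ^+ 2 < q ^+ 2 by move: bv; rewrite Ze !expr2; clear; lia.
have gb2 : (g + 2 <= b)%N by move: ga ab; clear; lia.
have d1 : d ^+ 2 = 1.
  have [//|/(lez_pmul (isT : 0 <= w%:Z)) w4] := sqr_unit_or_ge4 dn0.
  have aq : q <= 2 * a%:Z.
    suff : q - 1 < 2 * a%:Z by clear; lia.
    apply: ltz_sqr; first by clear; lia.
    apply: (lt_trans lu); rewrite PoszM expr2.
    have a0 : 0 < a%:Z by rewrite ltz_nat (leq_ltn_trans _ ga).
    have : g%:Z < a%:Z by [].
    by rewrite -(ltr_pM2r a0); clear; lia.
  exfalso; have := gap_uw gb2; move: bw' w4 lu aq q3; rewrite !expr2.
  by move: (u%:Z) (w%:Z) (a%:Z) => U T A; clear; lia.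
rewrite d1 mulr1 in bw'.
have uv : u%:Z < v%:Z.
  rewrite ltz_nat ltn_mul2l ab andbT.
  by have := square_free_gt0 sv; rewrite muln_gt0 => /andP[].
have eP2 : 2 * P = q ^+ 2 + 4 * u%:Z - v%:Z * c ^+ 2 - w%:Z.
  move: eP; rewrite Ze We.
  have -> : v%:Z * (2 * c) ^+ 2 = 4 * v%:Z * c ^+ 2 by ring.
  have -> : w%:Z * (2 * d) ^+ 2 = 4 * w%:Z * d ^+ 2 by ring.
  by rewrite d1 !expr2; clear; lia.
have eQ2 : Q = 2 * q - b%:Z * (c * d) by move: eQ; rewrite Ze We; clear; lia.
have [c1|c2|c3] := sqr_unit_or_two_or_ge9 cn0.
- have [y [by'|by']] := intz_parity b%:Z.
    by move: eP2; rewrite c1 !PoszM by' qi !expr2; clear; lia.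
  have [h [gah|gah]] := intz_parity (g%:Z + a%:Z).
    exfalso; move: eP2.
    have -> : v%:Z = b%:Z * (2 * h) - w%:Z by rewrite -gah !PoszM; ring.
    by rewrite c1 qi !expr2; clear; lia.
  have [n un] : exists n, u%:Z = 2 * n.
    have [x [gx|gx]] := intz_parity g%:Z; first by exists (x * a%:Z); rewrite PoszM gx; ring.
    exists (g%:Z * (h - x)); rewrite PoszM.
    have -> : a%:Z = 2 * (h - x) by move: gah; rewrite gx; clear; lia.
    by ring.
  have [z [nz|nz]] := intz_parity n.
    by case: (square_free_mod4 su (m := z)); rewrite un nz; clear; lia.
  have [x Qx] : exists x, Q = 2 * x + 1.
    have [x [Qx|Qx]] := intz_parity Q; last by exists x.
    have [s [cs|cs]] := intz_parity c; first by move: c1; rewrite cs !expr2; clear; lia.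
    have [r [dr|dr]] := intz_parity d; first by move: d1; rewrite dr !expr2; clear; lia.
    by exfalso; move: eQ2; rewrite Qx by' cs dr; clear; lia.
  have [p [Pp|Pp]] := intz_parity P;
    by move: eN; rewrite un nz Pp Qx !expr2; clear; lia.
- have [l [wl|wl]] := intz_parity w%:Z.
    by move: eP2; rewrite wl c2 qi !expr2; clear; lia.
  have ab2 : a%:Z + 2 <= b%:Z.
    have [x [ax|ax]] := intz_parity a%:Z; first by move: wl; rewrite PoszM ax; clear; lia.
    have [y [by'|by']] := intz_parity b%:Z; first by move: wl; rewrite PoszM by'; clear; lia.
    by move: ab; rewrite -ltz_nat ax by'; clear; lia.
  have aq : a%:Z <= q - 1.
    suff : a%:Z < q by clear; lia.
    apply: ltz_sqr; first by move: q3; clear; lia.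
    apply: le_lt_trans bw'; rewrite expr2 -PoszM lez_nat leq_mul2l ltnW ?orbT//.
  have gq : q <= 4 * g%:Z.
    suff : q - 1 < 4 * g%:Z by clear; lia.
    have q1 : 0 < q - 1 by move: q3; clear; lia.
    rewrite -(ltr_pM2r q1); have := lez_pmul (isT : 0 <= g%:Z) aq.
    by move: lu; rewrite !expr2; clear; lia.
  have := lez_pmul (isT : 0 <= g%:Z) ab2.
  move: bv' lu gq q3; rewrite c2 !expr2; clear; lia.
have := lez_pmul (isT : 0 <= v%:Z) c3.
have q0 : 0 <= q - 3 by move: q3; clear; lia.
have := mulr_ge0 q0 q0; move: bv' uv lu q3; rewrite !expr2.
by move: (u%:Z) (v%:Z) => U V; clear; lia.
Qed.

(** Here 2 U - 1 = q + sqrt u with q even, and the argument of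
    no_trace_calU_mod23 applies with b >= g + 2. *)
Lemma no_trace_twice_mod1 (q i Z W : int) : 2 <= q -> q = 2 * i ->
  (exists m, u%:Z = 4 * m + 1) -> (g + 2 <= b)%N -> (q - 1) ^+ 2 < u%:Z ->
  integral_coords g a b (2 * q) 2 Z W ->
  positive_coords R g a b (2 * q) 2 Z W -> False.
Proof.
move=> q2 qi [m um] gb2 lu [_ iv iw [P [Q [eP _ _]]]] pos.
have [_ bu bv bw] := positive_bounds pos.
have gap := positive_gap pos.
have [d We] := quad_integer_even sw iw.
have ltq : (q - 1)%:~R < rsqrt R u.
  by apply: int_lt_rsqrt => //; move: q2; clear; lia.
have [d0|/eqP dn0] := eqVneq d 0.
  have Z0 : Z = 0.
    apply: (small_even_zero sv iv).
    have [|_ h2] := @lt_sqrt_int R v Z 2; last by move: h2; rewrite [2 ^+ 2]expr2.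
    move: gap; rewrite We d0 mulr0 mul0r subr0 => /andP[].
    move: ltq; rewrite !(rmorphM, rmorphB) /= => h1 h2 h3.
    by apply/andP; split; lra.
  by move: eP; rewrite We d0 Z0 qi um !expr2; clear; lia.
have bw' : w%:Z * d ^+ 2 < q ^+ 2 by move: bw; rewrite We !expr2; clear; lia.
have := lez_pmul (isT : 0 <= w%:Z) (sqr_ge1 dn0); rewrite mulr1 => w1.
have := ltz_factor lu; have := gap_uw gb2; move: w1 bw' lu q2; rewrite !expr2.
by move: (u%:Z) (w%:Z) (a%:Z) => U T A; clear; lia.
Qed.
End Gaps.

(** * Splittings of the trace *)

Lemma sqrt_linear_bound (n : nat) (X Y j : int) :
  0 < X -> n%:Z * Y ^+ 2 < X ^+ 2 -> 0 <= j -> j ^+ 2 < n%:Z ->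
  Y * j < X /\ - Y * j < X.
Proof.
move=> X0 lt j0 ltj.
have lt2 : (Y * j) ^+ 2 < X ^+ 2.
  apply: le_lt_trans lt; rewrite exprMn mulrC ler_wpM2r ?sqr_ge0 ?ltW//.
split; apply: ltz_sqr (ltW X0) _ => //.
by rewrite mulNr sqrrN.
Qed.

(** Totally positive integers x + y sqrt u satisfy x >= |y| j + e, where j is the
    integer or odd integer just below sqrt u and e = 1, or e = 2 when the
    coordinates are doubled and their parities agree.  If y1 and y2 had
    opposite signs, these bounds would exceed the prescribed sum. *)
Lemma trace_split_two (e j x1 y1 x2 y2 : int) :
  0 < e -> 0 < j ->
  y1 * j + e <= x1 -> - y1 * j + e <= x1 ->
  y2 * j + e <= x2 -> - y2 * j + e <= x2 ->
  x1 + x2 = 2 * (j + e) -> y1 + y2 = 2 ->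
  [\/ x1 = j + e /\ y1 = 1, x1 = e /\ y1 = 0 | x2 = e /\ y2 = 0].
Proof.
move=> e0 j0 l1 l1' l2 l2' ex ey.
have : 0 <= y1 <= 2 by nia.
move=> /andP[y0 y2']; have [y|[y|y]] : y1 = 0 \/ y1 = 1 \/ y1 = 2 by lia.
- constructor 2; split => //; have y2e : y2 = 2 by lia.
  by move: l1 l2 ex; rewrite y y2e; lia.
- constructor 1; split => //; have y2e : y2 = 1 by lia.
  by move: l1 l2 ex; rewrite y y2e; lia.
- constructor 3; have y2e : y2 = 0 by lia.
  by split => //; move: l1 l2 ex; rewrite y y2e; lia.
Qed.

Lemma trace_split_four (e j x1 y1 x2 y2 : int) :
  0 < e -> 0 < j ->
  y1 * j + e <= x1 -> - y1 * j + e <= x1 ->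
  y2 * j + e <= x2 -> - y2 * j + e <= x2 ->
  x1 + x2 = 2 * (2 * j + e) -> y1 + y2 = 4 ->
  [\/ x1 = 2 * j + e /\ y1 = 2, (x1 = j + e /\ y1 = 1) \/ (x2 = j + e /\ y2 = 1)
   | (x1 = e /\ y1 = 0) \/ (x2 = e /\ y2 = 0)].
Proof.
move=> e0 j0 l1 l1' l2 l2' ex ey.
have : 0 <= y1 <= 4 by nia.
move=> /andP[y0 y4]; have [y|[y|[y|[y|y]]]] :
  y1 = 0 \/ y1 = 1 \/ y1 = 2 \/ y1 = 3 \/ y1 = 4 by lia.
- constructor 3; left; split => //; have y2e : y2 = 4 by lia.
  by move: l1 l2 ex; rewrite y y2e; lia.
- constructor 2; left; split => //; have y2e : y2 = 3 by lia.
  by move: l1 l2 ex; rewrite y y2e; lia.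
- constructor 1; split => //; have y2e : y2 = 2 by lia.
  by move: l1 l2 ex; rewrite y y2e; lia.
- constructor 2; right; have y2e : y2 = 1 by lia.
  by split => //; move: l1 l2 ex; rewrite y y2e; lia.
- constructor 3; right; have y2e : y2 = 0 by lia.
  by split => //; move: l1 l2 ex; rewrite y y2e; lia.
Qed.

Section Decomposition.
Variables (R : realType) (g a b : nat).
Local Notation u := (g * a)%N.
Local Notation v := (g * b)%N.
Local Notation w := (a * b)%N.
Hypotheses (su : square_free u) (sv : square_free v) (sw : square_free w).
Hypotheses (ga : (g < a)%N) (gb : (g < b)%N).

Definition OK_coords (X Y Z W : int) :=
  integral_coords g a b X Y Z W /\ positive_coords R g a b X Y Z W.

Section Mod23.
Hypothesis u1 : forall m : int, u%:Z <> 4 * m + 1.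
Variable k : int.
Hypotheses (k2 : 2 <= k) (lu : (k - 1) ^+ 2 < u%:Z).

Lemma OK_coords_mod23 X Y Z W : OK_coords X Y Z W ->
  exists x y, [/\ X = 2 * x, Y = 2 * y, y * (k - 1) + 1 <= x
                & - y * (k - 1) + 1 <= x].
Proof.
move=> [[iu _ _ _] /positive_bounds[X0 bu _ _]].
have [x [Xx|Xx]] := intz_parity X; last first.
  rewrite Xx in iu; have [c [m [_ um]]] := quad_integer_odd iu.
  by case: (u1 um).
have [y Yy] : exists y, Y = 2 * y by apply: (quad_integer_even su (X := x)); rewrite -Xx.
exists x, y; split => //.
all: have k0 : 0 <= k - 1 by move: k2; clear; lia.
all: have [] := sqrt_linear_bound X0 bu k0 lu; rewrite Xx Yy; clear; lia.
Qed.

(** The sums are the coordinates of 4 U, where U = k + sqrt u. *)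
Lemma indecomposable_coords_mod23 X1 Y1 Z1 W1 X2 Y2 Z2 W2 :
  a <> b -> u%:Z < k ^+ 2 ->
  X1 + X2 = 4 * k -> Y1 + Y2 = 4 ->
  OK_coords X1 Y1 Z1 W1 -> OK_coords X2 Y2 Z2 W2 -> False.
Proof.
move=> ab hu eX eY ok1 ok2.
have [x1 [y1 [X1e Y1e l1 l1']]] := OK_coords_mod23 ok1.
have [x2 [y2 [X2e Y2e l2 l2']]] := OK_coords_mod23 ok2.
have [||||[ex ey]|[ex ey]|[ex ey]] :=
  @trace_split_two 1 (k - 1) x1 y1 x2 y2 _ _ l1 l1' l2 l2'.
- by [].
- by move: k2; clear; lia.
- by move: eX; rewrite X1e X2e; clear; lia.
- by move: eY; rewrite Y1e Y2e; clear; lia.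
- case: ok1; rewrite X1e Y1e ex ey subrK.
  exact: no_trace_calU_mod23.
- by case: ok1; rewrite X1e Y1e ex ey; exact: no_trace_one.
- by case: ok2; rewrite X2e Y2e ex ey; exact: no_trace_one.
Qed.

(** The sums are the coordinates of 4 (2 U - 1). *)
Lemma twice_indecomposable_coords_mod23 X1 Y1 Z1 W1 X2 Y2 Z2 W2 :
  (a < b)%N -> u%:Z < k ^+ 2 ->
  X1 + X2 = 4 * (2 * k - 1) -> Y1 + Y2 = 8 ->
  OK_coords X1 Y1 Z1 W1 -> OK_coords X2 Y2 Z2 W2 -> False.
Proof.
move=> ab hu eX eY ok1 ok2.
have ab' : a <> b by move: ab; clear; lia.
have [x1 [y1 [X1e Y1e l1 l1']]] := OK_coords_mod23 ok1.
have [x2 [y2 [X2e Y2e l2 l2']]] := OK_coords_mod23 ok2.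
have [||||[ex ey]|[[ex ey]|[ex ey]]|[[ex ey]|[ex ey]]] :=
  @trace_split_four 1 (k - 1) x1 y1 x2 y2 _ _ l1 l1' l2 l2'.
- by [].
- by move: k2; clear; lia.
- by move: eX; rewrite X1e X2e; clear; lia.
- by move: eY; rewrite Y1e Y2e; clear; lia.
- case: ok1; rewrite X1e Y1e ex ey.
  apply: (no_trace_twice_mod23 su sv sw ga (i := k - 1)) => //.
  + by move: k2; clear; lia.
  + by move: lu; rewrite !expr2; clear; lia.
- by case: ok1; rewrite X1e Y1e ex ey subrK; exact: no_trace_calU_mod23.
- by case: ok2; rewrite X2e Y2e ex ey subrK; exact: no_trace_calU_mod23.
- by case: ok1; rewrite X1e Y1e ex ey; exact: no_trace_one.
- by case: ok2; rewrite X2e Y2e ex ey; exact: no_trace_one.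
Qed.
End Mod23.

Section Mod1.
Variables (m k l : int).
Hypotheses (um : u%:Z = 4 * m + 1) (k3 : 3 <= k) (kl : k = 2 * l + 1)
  (lu : (k - 2) ^+ 2 < u%:Z).

(** The bound improves by one because X, Y and Y (k - 2) have the same parity. *)
Lemma OK_coords_mod1 X Y Z W : OK_coords X Y Z W ->
  Y * (k - 2) + 2 <= X /\ - Y * (k - 2) + 2 <= X.
Proof.
move=> [[iu _ _ _] /positive_bounds[X0 bu _ _]].
have k0 : 0 <= k - 2 by move: k3; clear; lia.
have [l1 l2] := sqrt_linear_bound X0 bu k0 lu.
have [t et] : exists t, X = Y + 2 * t.
  have [x [Xx|Xx]] := intz_parity X; rewrite Xx in iu.
    have [y ->] := quad_integer_even su iu.
    by exists (x - y); rewrite Xx; clear; lia.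
  have [y [_ [-> _]]] := quad_integer_odd iu.
  by exists (x - y); rewrite Xx; clear; lia.
by move: l1 l2; rewrite kl et; clear; lia.
Qed.

(** The sums are the coordinates of 4 U, where U = (k + sqrt u) / 2. *)
Lemma indecomposable_coords_mod1 X1 Y1 Z1 W1 X2 Y2 Z2 W2 :
  X1 + X2 = 2 * k -> Y1 + Y2 = 2 ->
  OK_coords X1 Y1 Z1 W1 -> OK_coords X2 Y2 Z2 W2 -> False.
Proof.
move=> eX eY ok1 ok2.
have [l1 l1'] := OK_coords_mod1 ok1; have [l2 l2'] := OK_coords_mod1 ok2.
have [||||[ex ey]|[ex ey]|[ex ey]] :=
  @trace_split_two 2 (k - 2) X1 Y1 X2 Y2 _ _ l1 l1' l2 l2'.
- by [].
- by move: k3; clear; lia.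
- by move: eX; clear; lia.
- by [].
- case: ok1; rewrite ex ey subrK.
  by apply: (no_trace_calU_mod1 ga gb um _ kl lu); move: k3; clear; lia.
- by case: ok1; rewrite ex ey; exact: no_trace_one.
- by case: ok2; rewrite ex ey; exact: no_trace_one.
Qed.

(** The sums are the coordinates of 4 (2 U - 1). *)
Lemma twice_indecomposable_coords_mod1 X1 Y1 Z1 W1 X2 Y2 Z2 W2 :
  (a < b)%N -> X1 + X2 = 4 * (k - 1) -> Y1 + Y2 = 4 ->
  OK_coords X1 Y1 Z1 W1 -> OK_coords X2 Y2 Z2 W2 -> False.
Proof.
move=> ab eX eY ok1 ok2.
have [l1 l1'] := OK_coords_mod1 ok1; have [l2 l2'] := OK_coords_mod1 ok2.
have [||||[ex ey]|[[ex ey]|[ex ey]]|[[ex ey]|[ex ey]]] :=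
  @trace_split_four 2 (k - 2) X1 Y1 X2 Y2 _ _ l1 l1' l2 l2'.
- by [].
- by move: k3; clear; lia.
- by move: eX; clear; lia.
- by [].
- case: ok1; rewrite ex ey (_ : 2 * (k - 2) + 2 = 2 * (k - 1)); last by clear; lia.
  apply: (no_trace_twice_mod1 sv sw ga (i := l)).
  + by move: k3; clear; lia.
  + by rewrite kl; clear; lia.
  + by exists m.
  + by move: ga ab; clear; lia.
  + by rewrite -addrA -opprD.
- case: ok1; rewrite ex ey subrK.
  by apply: (no_trace_calU_mod1 ga gb um _ kl lu); move: k3; clear; lia.
- case: ok2; rewrite ex ey subrK.
  by apply: (no_trace_calU_mod1 ga gb um _ kl lu); move: k3; clear; lia.
- by case: ok1; rewrite ex ey; exact: no_trace_one.
- by case: ok2; rewrite ex ey; exact: no_trace_one.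
Qed.
End Mod1.
End Decomposition.

(** * The element attached to a radicand *)

Lemma integral_quadratic (K : fieldType) (z : K) (B C : int) :
  z ^+ 2 = B%:~R * z + C%:~R -> integralOver (intr : int -> K) z.
Proof.
move=> ez; pose f : {poly int} := 'X^2 - (B *: 'X + C%:P).
have sf : (size (B *: 'X + C%:P)%R <= 2)%N.
  by rewrite -mul_polyC size_MXaddC; case: ifP => // _; rewrite ltnS size_polyC leq_b1.
exists f.
  by rewrite /f monicE lead_coefDl ?lead_coefXn// size_polyXn size_polyN ltnS.
rewrite /f rmorphB rmorphD /= map_polyXn map_polyZ map_polyX map_polyC /=.
by rewrite rootE !(hornerE, hornerXn) /= ez subrr.
Qed.

Section Ceil.
Variables (R : realType) (u : nat).
Hypotheses (su : square_free u) (u1 : (1 < u)%N).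

(** Hence the ceilings below are bounded by strict inequalities on both sides. *)
Lemma square_free_neq_sqr (j : int) : j ^+ 2 != u%:Z.
Proof.
apply/eqP => e; have e' : (`|j| ^ 2 = u)%N.
  by have := congr1 absz e; rewrite abszX.
have := @su `|j|%N; rewrite e' dvdnn => /(_ isT) j1.
by move: u1; rewrite -e' j1.
Qed.

Lemma rsqrt_lt_nat (n : nat) : (rsqrt R u < n%:R) = (u%:Z < n%:Z ^+ 2).
Proof.
rewrite -(@ltr_pXn2r _ 2)// ?nnegrE ?rsqrt_ge0//.
by rewrite sqr_rsqrt -natrX ltr_nat -ltz_nat PoszM expr2.
Qed.

Lemma ceil_sqrtP : let k := (ceil_sqrt R u)%:Z in
  [/\ 2 <= k, (k - 1) ^+ 2 < u%:Z & u%:Z < k ^+ 2].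
Proof.
rewrite /= /ceil_sqrt; case: ex_minnP => k; rewrite rsqrt_lt_nat => lt min.
have k2 : (1 < k)%N.
  rewrite -ltz_nat; apply: ltz_sqr => //; apply: le_lt_trans lt.
  by move: u1; rewrite expr2; clear; lia.
split => //.
have -> : k%:Z - 1 = (k - 1)%N%:Z by move: k2; clear; lia.
rewrite lt_neqAle square_free_neq_sqr /=.
rewrite leNgt -rsqrt_lt_nat; apply/negP => /min.
by move: k2; clear; lia.
Qed.

Lemma odd_ceil_sqrtP : let k := (odd_ceil_sqrt R u)%:Z in
  [/\ 3 <= k, exists l, k = 2 * l + 1, (k - 2) ^+ 2 < u%:Z & u%:Z < k ^+ 2].
Proof.
rewrite /= /odd_ceil_sqrt; case: ex_minnP => k; rewrite rsqrt_lt_nat => /andP[ok lt] min.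
have k2 : (1 < k)%N.
  rewrite -ltz_nat; apply: ltz_sqr => //; apply: le_lt_trans lt.
  by move: u1; rewrite expr2; clear; lia.
have k3 : (2 < k)%N by move: ok k2; case: (k) => [|[|[|]]].
split => //.
  by exists (k./2)%:Z; move: (odd_double_half k); rewrite ok; clear; lia.
have -> : k%:Z - 2 = (k - 2)%N%:Z by move: k2; clear; lia.
rewrite lt_neqAle square_free_neq_sqr /=.
rewrite leNgt -rsqrt_lt_nat; apply/negP => lt'.
have ok2 : odd (k - 2) by move: ok k2; clear; lia.
have := min (k - 2)%N; rewrite lt' ok2 /= => /(_ isT).
by move: k2; clear; lia.
Qed.
End Ceil.

Section CalU.
Variables (R : realType) (A : seq R) (u : nat).
Hypotheses (su : square_free u) (u1 : (1 < u)%N).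
Hypothesis hu : rsqrt R u \in subfield_gen A.
Local Notation K := (Qadj A).
Local Notation r := (InQadj hu : K).

Lemma sqr_root : r ^+ 2 = u%:R.
Proof. by apply: val_inj; rewrite rmorphXn rmorph_nat /= sqr_rsqrt. Qed.

Lemma rmorph_root_bound (sigma : {rmorphism K -> R}) (k : int) :
  0 <= k -> u%:Z < k ^+ 2 -> 0 < k%:~R + sigma r.
Proof.
move=> k0 lt; rewrite -ltrBlDl sub0r.
have : `|sigma r| < k%:~R.
  rewrite -(@ltr_pXn2r _ 2)// ?nnegrE ?normr_ge0 ?ler0z//.
  rewrite real_normK ?num_real// -rmorphXn sqr_root rmorph_nat pmulrn.
  by rewrite -rmorphXn /= ltr_int.
by rewrite ltr_norml => /andP[].
Qed.

Lemma integral_root : integer_of r.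
Proof.
apply: (@integral_quadratic _ _ 0 u%:Z).
by rewrite sqr_root mul0r add0r.
Qed.

Lemma calU_mod23 : (forall m : int, u%:Z <> 4 * m + 1) ->
  calU hu = (ceil_sqrt R u)%:R + r.
Proof.
move=> h; rewrite /calU; case: eqP => // e; case: (h (u %/ 4)%N).
by move: (divn_eq u 4); rewrite e; clear; lia.
Qed.

Lemma calU_mod1 (m : int) : u%:Z = 4 * m + 1 ->
  calU hu = ((odd_ceil_sqrt R u)%:R + r) / 2%:R.
Proof.
move=> h; rewrite /calU (_ : (u %% 4 == 1)%N)//.
by move: h; clear; lia.
Qed.

Lemma val_calU_mod23 : (forall m : int, u%:Z <> 4 * m + 1) ->
  val (calU hu) = (ceil_sqrt R u)%:R + rsqrt R u.
Proof. by move=> h; rewrite calU_mod23// rmorphD rmorph_nat. Qed.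

Lemma val_calU_mod1 (m : int) : u%:Z = 4 * m + 1 ->
  val (calU hu) = ((odd_ceil_sqrt R u)%:R + rsqrt R u) / 2%:R.
Proof.
by move=> h; rewrite (calU_mod1 h) rmorphM fmorphV rmorphD !rmorph_nat.
Qed.

Lemma val_twice_calU : val (2%:R * calU hu - 1) = 2%:R * val (calU hu) - 1.
Proof. by rewrite rmorphB rmorph1 rmorphM rmorph_nat. Qed.

Lemma two_neq0 : 2%:R != 0 :> K.
Proof.
apply/negP => /eqP /(congr1 (val : K -> R)); rewrite rmorph_nat rmorph0.
by apply/eqP; rewrite pnatr_eq0.
Qed.

Lemma OKplus_calU : OKplus R (calU hu).
Proof.
have [[m um]|h] := pselect (exists m : int, u%:Z = 4 * m + 1).
  have [k3 [l kl] lu ltu] := odd_ceil_sqrtP R su u1.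
  rewrite (calU_mod1 um); set k := odd_ceil_sqrt R u in k3 kl ltu *.
  split.
    apply: (@integral_quadratic _ _ k%:Z (m - l ^+ 2 - l)).
    have ku : u%:Z = k%:Z ^+ 2 + 4 * (m - l ^+ 2 - l).
      by rewrite um kl !expr2; clear; lia.
    have /(congr1 (fun x : int => x%:~R : K)) := ku.
    rewrite rmorphD rmorphXn rmorphM /= -[in LHS]pmulrn -sqr_root => eu.
    apply: (mulfI (expf_neq0 2 two_neq0)).
    transitivity ((k%:R + r) ^+ 2); first by field; exact: two_neq0.
    rewrite sqrrD eu -!pmulrn; field; exact: two_neq0.
  move=> sigma; rewrite rmorphM fmorphV rmorphD !rmorph_nat divr_gt0//.
  by have := @rmorph_root_bound sigma k%:Z (ltW (lt_le_trans _ k3)) ltu; apply.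
rewrite calU_mod23; last by move=> m um; apply: h; exists m.
have [k2 lu ltu] := ceil_sqrtP R su u1.
split.
  apply: integral_add; [exact: integral_nat | exact: integral_root].
move=> sigma; rewrite rmorphD rmorph_nat.
by rewrite pmulrn; exact: rmorph_root_bound.
Qed.
End CalU.

(** * Indecomposability from coordinates *)

Section Criterion.
Variables (R : realType) (A : seq R) (g a b : nat).
Local Notation u := (g * a)%N.
Local Notation v := (g * b)%N.
Local Notation w := (a * b)%N.
Local Notation K := (Qadj A).
Hypotheses (su : square_free u) (sv : square_free v) (sw : square_free w).
Hypotheses (ga : (g < a)%N) (gb : (g < b)%N) (ab : a <> b).
Hypothesis hA : {subset A <= [:: rsqrt R u; rsqrt R v]}.
Hypothesis hu : rsqrt R u \in subfield_gen A.
Local Notation U := (calU hu).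

Lemma g_gt0 : (0 < g)%N.
Proof. by have := square_free_gt0 su; rewrite muln_gt0 => /andP[]. Qed.

Lemma u_gt1 : (1 < u)%N.
Proof. by have := g_gt0; move: ga; clear; nia. Qed.

Lemma v_gt1 : (1 < v)%N.
Proof. by have := g_gt0; move: gb; clear; nia. Qed.

Lemma u_neq_v : u <> v.
Proof. by move=> /eqP; rewrite eqn_pmul2l ?g_gt0// => /eqP. Qed.

Lemma int_combD X Y Z W X' Y' Z' W' :
  int_comb R g a b X Y Z W + int_comb R g a b X' Y' Z' W' =
  int_comb R g a b (X + X') (Y + Y') (Z + Z') (W + W').
Proof. by rewrite /int_comb !rmorphD /=; ring. Qed.

Lemma indecomposable_of_coords (x : K) (X Y : int) : OKplus R x ->
  4%:R * val x = X%:~R + Y%:~R * rsqrt R u ->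
  (forall X1 Y1 Z1 W1 X2 Y2 Z2 W2, X1 + X2 = X -> Y1 + Y2 = Y ->
    OK_coords R g a b X1 Y1 Z1 W1 -> OK_coords R g a b X2 Y2 Z2 W2 -> False) ->
  indecomposable R x.
Proof.
move=> okx ex noXY; split=> // -[c [d [okc okd ecd]]].
have coords := OKplus_coords su sv sw u_gt1 v_gt1 u_neq_v hA.
have [X1 [Y1 [Z1 [W1 [e1 i1 p1]]]]] := coords _ okc.
have [X2 [Y2 [Z2 [W2 [e2 i2 p2]]]]] := coords _ okd.
have : int_comb R g a b (X1 + X2) (Y1 + Y2) (Z1 + Z2) (W1 + W2) =
       int_comb R g a b X Y 0 0.
  rewrite -int_combD -e1 -e2 -mulrDr -(rmorphD (val : K -> R)) -ecd ex.
  by rewrite /int_comb !mul0r !addr0.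
move=> /(int_comb_inj su sv u_gt1 v_gt1 u_neq_v) [eX eY _ _].
exact: (noXY _ _ _ _ _ _ _ _ eX eY (conj i1 p1) (conj i2 p2)).
Qed.

Lemma indecomposable_calU : indecomposable R U.
Proof.
have okU := OKplus_calU su u_gt1 hu.
have [[m um]|h] := pselect (exists m : int, u%:Z = 4 * m + 1).
  have [k3 [l kl] lu ltu] := odd_ceil_sqrtP R su u_gt1.
  apply: (@indecomposable_of_coords _ (2 * (odd_ceil_sqrt R u)%:Z) 2 okU).
    rewrite (val_calU_mod1 hu um) rmorphM /= -pmulrn.
    by field.
  exact: (indecomposable_coords_mod1 su sv sw ga gb um k3 kl lu).
have u1 : forall m : int, u%:Z <> 4 * m + 1 by move=> m um; apply: h; exists m.
have [k2 lu ltu] := ceil_sqrtP R su u_gt1.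
apply: (@indecomposable_of_coords _ (4 * (ceil_sqrt R u)%:Z) 4 okU).
  rewrite (val_calU_mod23 hu u1) rmorphM /= -pmulrn.
  by ring.
move=> X1 Y1 Z1 W1 X2 Y2 Z2 W2.
exact: (indecomposable_coords_mod23 su sv sw ga gb u1 k2 lu ab ltu).
Qed.

Lemma indecomposable_twice_calU : (a < b)%N ->
  totally_positive R (2%:R * U - 1) -> indecomposable R (2%:R * U - 1).
Proof.
move=> ltab posU.
have okU : OKplus R (2%:R * U - 1).
  split=> //; apply: integral_sub; last exact: integral1.
  by apply: integral_mul; [exact: integral_nat | case: (OKplus_calU su u_gt1 hu)].
have [[m um]|h] := pselect (exists m : int, u%:Z = 4 * m + 1).
  have [k3 [l kl] lu ltu] := odd_ceil_sqrtP R su u_gt1.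
  apply: (@indecomposable_of_coords _ (4 * ((odd_ceil_sqrt R u)%:Z - 1)) 4 okU).
    rewrite val_twice_calU (val_calU_mod1 hu um) rmorphM rmorphB /= -pmulrn.
    by field.
  move=> X1 Y1 Z1 W1 X2 Y2 Z2 W2.
  exact: (twice_indecomposable_coords_mod1 su sv sw ga gb um k3 kl lu ltab).
have u1 : forall m : int, u%:Z <> 4 * m + 1 by move=> m um; apply: h; exists m.
have [k2 lu ltu] := ceil_sqrtP R su u_gt1.
apply: (@indecomposable_of_coords _ (4 * (2 * (ceil_sqrt R u)%:Z - 1)) 8 okU).
  rewrite val_twice_calU (val_calU_mod23 hu u1) rmorphM rmorphB rmorphM /= -pmulrn.
  by ring.
move=> X1 Y1 Z1 W1 X2 Y2 Z2 W2.
exact: (twice_indecomposable_coords_mod23 su sv sw ga gb u1 k2 lu ltab ltu).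
Qed.
End Criterion.

(** * The third square root *)

Lemma square_free_dvd d n : square_free n -> (d %| n)%N -> square_free d.
Proof. by move=> sn dn e ed; apply: sn; apply: dvdn_trans dn. Qed.

Lemma square_free_coprimeM m n :
  square_free m -> square_free n -> coprime m n -> square_free (m * n).
Proof.
move=> sm sn cop d dmn; apply/eqP; apply: contraT => d1.
have mn0 : (0 < m * n)%N by rewrite muln_gt0 !square_free_gt0.
have d0 : (0 < d)%N by case: d dmn {d1} => //; rewrite exp0n// dvd0n; move: mn0;
    case: (m * n)%N.
have d2 : (1 < d)%N by rewrite ltn_neqAle eq_sym d1.
have pp := pdiv_prime d2; set p := pdiv d in pp.
have : (p ^ 2 %| m * n)%N by apply: dvdn_trans dmn; rewrite dvdn_exp2r ?pdiv_dvd.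
rewrite pfactor_dvdn// lognM ?square_free_gt0//.
have := logn_square_free p sm; have := logn_square_free p sn.
have [pm|pm] := boolP (p %| m)%N; last first.
  by rewrite [logn p m]logn_coprime ?prime_coprime//; lia.
have pn : ~~ (p %| n)%N.
  by rewrite -prime_coprime//; apply: coprime_dvdl pm cop.
by rewrite [logn p n]logn_coprime ?prime_coprime//; lia.
Qed.

Lemma rsqrt_coords_sqr (R : realType) (t n : nat) (x : rat) (z : R) :
  square_free t -> square_free n -> z ^+ 2 = n%:R ->
  rsqrt R t = ratr x * z -> t = n.
Proof.
move=> st sn hz et.
have e : x ^+ 2 * n%:R = 1 ^+ 2 * t%:R.
  apply: (fmorph_inj (ratr : rat -> R)).
  rewrite expr1n mul1r expr2 !rmorphM /= !ratr_nat -hz -(sqr_rsqrt R t) et.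
  by ring.
by have [->//|[_ /eqP]] := square_free_square_ratio sn st e.
Qed.

(** Every conjugate of sqrt t is sqrt t or its opposite.  Comparing the
    coordinates of two conjugates with these leaves a single nonzero
    coordinate, so t is 1, m, s or a b up to a rational square. *)
Lemma third_root (R : realType) (m s t : nat) :
  square_free m -> square_free s -> square_free t ->
  (1 < m)%N -> (m < s)%N -> (s < t)%N ->
  rsqrt R t \in subfield_gen (sqrts R m s) ->
  exists g a b, [/\ m = (g * a)%N, s = (g * b)%N, t = (a * b)%N & (g < a < b)%N].
Proof.
move=> sm ss st m1 ms s_t ht.
have s1 := ltn_trans m1 ms.
have ms' : m <> s by move: ms; clear; lia.
pose g := gcdn m s; pose a := (m %/ g)%N; pose b := (s %/ g)%N.
have g0 : (0 < g)%N by rewrite gcdn_gt0 ltnW.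
have mE : m = (g * a)%N by rewrite mulnC divnK ?dvdn_gcdl.
have sE : s = (g * b)%N by rewrite mulnC divnK ?dvdn_gcdr.
have cop : coprime a b.
  by rewrite /coprime -(eqn_pmul2l g0) muln1 muln_gcdr -mE -sE.
have sw : square_free (a * b).
  apply: square_free_coprimeM cop.
  - by apply: square_free_dvd sm _; rewrite mE dvdn_mull.
  - by apply: square_free_dvd ss _; rewrite sE dvdn_mull.
suff tE : t = (a * b)%N.
  exists g, a, b; split => //; apply/andP; split.
    by move: s_t; rewrite sE tE ltn_mul2r => /andP[].
  by move: ms; rewrite mE sE ltn_mul2l => /andP[].
have hA : {subset sqrts R m s <= [:: rsqrt R m; rsqrt R s]} by [].
set p := rsqrt R m; set q := rsqrt R s.
have hp : p ^+ 2 = m%:R by exact: sqr_rsqrt.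
have hq : q ^+ 2 = s%:R by exact: sqr_rsqrt.
have hNp : (- p) ^+ 2 = m%:R by rewrite sqrrN.
have hNq : (- q) ^+ 2 = s%:R by rewrite sqrrN.
have [x [y [z [w et]]]] := subfield_coords sm ss m1 s1 ms' hA ht.
have conj p' q' : p' ^+ 2 = m%:R -> q' ^+ 2 = s%:R ->
    comb p' q' x y z w = comb p q x y z w \/
    comb p' q' x y z w = - comb p q x y z w.
  move=> hp' hq'.
  have [sigma sE'] := exists_conjugation sm ss m1 s1 ms' hA hp' hq'.
  have := sE' (InQadj ht) _ _ _ _ et => <-; rewrite -et.
  have /eqP : sigma (InQadj ht) ^+ 2 = rsqrt R t ^+ 2.
    by rewrite -rmorphXn sqr_root rmorph_nat sqr_rsqrt.
  by rewrite eqf_sqr => /orP[] /eqP; [left | right].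
have combN : - comb p q x y z w = comb p q (- x) (- y) (- z) (- w).
  by rewrite /comb !rmorphN /=; ring.
have flipq : comb p (- q) x y z w = comb p q x y (- z) (- w).
  by rewrite /comb !rmorphN /=; ring.
have flipp : comb (- p) q x y z w = comb p q x (- y) z (- w).
  by rewrite /comb !rmorphN /=; ring.
have inj := comb_inj sm ss m1 s1 ms' hp hq.
have self0 (r : rat) : - r = r -> r = 0 by lra.
have self0' (r : rat) : r = - r -> r = 0 by lra.
have s_1 : square_free 1.
  by move=> d; rewrite dvdn1 -mulnn muln_eq1 => /andP[/eqP].
have := conj _ _ hp hNq; have := conj _ _ hNp hq; rewrite combN flipq flipp.
move=> [/inj[_ /self0 y0 _ /self0 w0]|/inj[/self0' x0 _ /self0' z0 _]]
  [/inj[_ _ /self0 z0' /self0 w0']|/inj[/self0' x0' /self0' y0' _ _]].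
- have et1 : rsqrt R t = ratr x * 1.
    by rewrite et /comb -/p -/q y0 z0' w0 !rmorph0; ring.
  have := rsqrt_coords_sqr st s_1 (expr1n _ _) et1.
  by move: m1 ms s_t; clear; lia.
- have ets : rsqrt R t = ratr z * q.
    by rewrite et /comb -/p -/q x0' y0' w0 !rmorph0; ring.
  have := rsqrt_coords_sqr st ss hq ets.
  by move: s_t; clear; lia.
- have etm : rsqrt R t = ratr y * p.
    by rewrite et /comb -/p -/q x0 z0 w0' !rmorph0; ring.
  have := rsqrt_coords_sqr st sm hp etm.
  by move: ms s_t; clear; lia.
- apply: (rsqrt_coords_sqr (x := w * g%:R) st sw (sqr_rsqrt R _)).
  rewrite rmorphM /= ratr_nat -mulrA -rsqrtM_common -mE -sE.
  by rewrite et /comb -/p -/q x0 y0' z0 !rmorph0; ring.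
Qed.

(** * A decomposition of T *)

Lemma square_free_check n :
  (0 < n)%N -> all (fun d => (d ^ 2 %| n)%N ==> (d == 1%N)) (iota 0 n.+1) ->
  square_free n.
Proof.
move=> n0 /allP h d dn; apply/eqP; move: (dn); apply/implyP; apply: h.
rewrite mem_iota /= ltnS; apply: dvdn_leq n0 _.
by apply: dvdn_trans dn; rewrite dvdn_mulr.
Qed.

Lemma integral_of_sqr (K : fieldType) (z : K) :
  integralOver (intr : int -> K) (z ^+ 2) -> integralOver (intr : int -> K) z.
Proof.
move=> iz; apply: (@integral_root_monic _ _ _ z ('X^2 - (z ^+ 2)%:P)).
- by rewrite monicE lead_coefDl ?lead_coefXn// size_polyXn size_polyN size_polyC; case: eqP.
- by rewrite rootE !(hornerE, hornerXn) subrr.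
- apply/integral_poly => i; rewrite coefB coefXn coefC.
  apply: integral_sub; first exact: integral_nat.
  by case: ifP => // _; exact: integral0.
Qed.

Lemma addr_gt0_of_sqr (R : realDomainType) (x y : R) :
  0 < x -> y ^+ 2 < x ^+ 2 -> 0 < x + y.
Proof.
move=> x0 lt; have : `|y| < x.
  by rewrite -(@ltr_pXn2r _ 2)// ?nnegrE ?(ltW x0)// real_normK ?num_real.
by rewrite ltr_norml => /andP[]; rewrite -subr_gt0 opprK addrC.
Qed.

Section Example.
Variable R : realType.
Local Notation A := (sqrts R 3 10).
Local Notation K := (Qadj A).

Lemma rsqrt_30 : rsqrt R 30 = rsqrt R 3 * rsqrt R 10.
Proof. by rewrite /rsqrt -sqrtrM// -natrM. Qed.

Lemma rsqrt_30_mem : rsqrt R 30 \in subfield_gen A.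
Proof. by rewrite rsqrt_30 rpredM ?rsqrt_meml ?rsqrt_memr. Qed.

Lemma square_free_3 : square_free 3. Proof. exact: square_free_check. Qed.
Lemma square_free_10 : square_free 10. Proof. exact: square_free_check. Qed.
Lemma square_free_30 : square_free 30. Proof. exact: square_free_check. Qed.

Lemma admissible_3_10_30 : admissible R 3 10 30.
Proof.
split; [by [] | split | | exact: rsqrt_30_mem].
- exact: square_free_3.
- exact: square_free_10.
- exact: square_free_30.
- exists 3%N, 10%N; split => //; [exact: square_free_3 | exact: square_free_10].
Qed.

Local Notation a := (InQadj (rsqrt_meml R 3 10) : K).
Local Notation b := (InQadj (rsqrt_memr R 3 10) : K).

Lemma calU_30 : calU rsqrt_30_mem = 6%:R + a * b.
Proof.
rewrite calU_mod23; last by move=> m; clear; lia.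
have -> : ceil_sqrt R 30 = 6%N.
  by have [] := ceil_sqrtP R square_free_30 isT; move: (ceil_sqrt R 30) => k; nia.
by congr (_ + _); apply: val_inj; rewrite rmorphM; exact: rsqrt_30.
Qed.

(** The square of (c + 1) d / 2 is 10 + 5 c.  This proves integrality, and also
    positivity: (3 + c)^2 = 12 + 6 c exceeds it by 2 + c. *)
Lemma summand_OKplus (c d : K) : c ^+ 2 = 3%:R -> d ^+ 2 = 10%:R ->
  OKplus R ((3%:R + c) + (c + 1) * d / 2%:R).
Proof.
move=> hc hd; split.
  have intc : integer_of c.
    by apply: integral_of_sqr; rewrite hc; exact: integral_nat.
  apply: integral_add; first by apply: integral_add intc; exact: integral_nat.
  apply: integral_of_sqr.
  have -> : ((c + 1) * d / 2%:R) ^+ 2 = 10%:R + 5%:R * c.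
    apply: (mulfI (expf_neq0 2 (two_neq0 _))).
    transitivity ((c ^+ 2 + 2%:R * c + 1) * d ^+ 2).
      by field; exact: two_neq0.
    by rewrite hc hd; ring.
  apply: integral_add; first exact: integral_nat.
  by apply: integral_mul intc; exact: integral_nat.
move=> sigma.
rewrite rmorphD (rmorphD _ 3%:R) !rmorphM fmorphV (rmorphD _ c) rmorph1 !rmorph_nat.
set c' := sigma c; set b' := sigma d.
have hc' : c' ^+ 2 = 3%:R by rewrite /c' -rmorphXn hc rmorph_nat.
have hb' : b' ^+ 2 = 10%:R by rewrite /b' -rmorphXn hd rmorph_nat.
have c3 : 0 < 2%:R + c' by apply: addr_gt0_of_sqr => //; rewrite hc'; lra.
apply: addr_gt0_of_sqr; first by lra.
have -> : ((c' + 1) * b' / 2%:R) ^+ 2 = (c' ^+ 2 + 2%:R * c' + 1) * b' ^+ 2 / 4%:R.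
  by field.
rewrite hb' sqrrD hc'; lra.
Qed.

Lemma calU_30_decomposes : ~ indecomposable R (calU rsqrt_30_mem).
Proof.
case=> _; apply.
have ha : a ^+ 2 = 3%:R by exact: sqr_root.
have hb : b ^+ 2 = 10%:R by exact: sqr_root.
exists ((3%:R + a) + (a + 1) * b / 2%:R), ((3%:R + - a) + (- a + 1) * (- b) / 2%:R).
split.
- exact: summand_OKplus.
- by apply: summand_OKplus; rewrite sqrrN.
- by rewrite calU_30; field; exact: two_neq0.
Qed.
End Example.

Theorem theorem1p3 (R : realType) :
  [/\ forall m s t : nat, admissible R m s t ->
        indecomposable R (calU (rsqrt_meml R m s)) /\
        indecomposable R (calU (rsqrt_memr R m s)),
      forall m s t : nat, admissible R m s t ->
        let M := calU (rsqrt_meml R m s) in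
        totally_positive R (2%:R * M - 1) -> indecomposable R (2%:R * M - 1)
    & exists (m s t : nat) (ht : rsqrt R t \in subfield_gen (sqrts R m s)),
        [/\ admissible R m s t, OKplus R (calU ht)
          & ~ indecomposable R (calU ht)]].
Proof.
split.
- move=> m s t [[m1 ms s_t] [sm ss st] _ ht].
  have [g [a [b [mE sE tE /andP[ga ab]]]]] := third_root sm ss st m1 ms s_t ht.
  have gb := ltn_trans ga ab.
  subst m s t; split.
    apply: (indecomposable_calU sm ss st ga gb) => //.
    by move: ab; clear; lia.
  have st' : square_free (b * a) by rewrite mulnC.
  apply: (indecomposable_calU ss sm st' gb ga).
  + by move: ab; clear; lia.
  + by move=> x; rewrite !inE orbC.
- move=> m s t [[m1 ms s_t] [sm ss st] _ ht] M.
  have [g [a [b [mE sE tE /andP[ga ab]]]]] := third_root sm ss st m1 ms s_t ht.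
  have gb := ltn_trans ga ab.
  rewrite /M; clear M; subst m s t.
  by apply: (indecomposable_twice_calU sm ss st ga gb) => //; move: ab; clear; lia.
- exists 3%N, 10%N, 30%N, (rsqrt_30_mem R); split.
  + exact: admissible_3_10_30.
  + by apply: OKplus_calU => //; exact: square_free_30.
  + exact: calU_30_decomposes.
Qed.
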